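(* Let $X_{0-}$ be a random variable with cumulative distribution function (CDF) $F$. Let $(X_{0-}^n)_{n\ge 1}$ be random variables on $[0,\infty)$ with CDFs $(F^n)_{n\ge 1}$, respectively, such that $F(x) \ge F^n(x)\ge F^m(x)$ for all $x\ge 0$ whenever $m<n$, and $F^n(x)\to F(x)$ whenever $x$ is a continuity point of $F$. For $n\ge 1$, let $\underline{\Lambda}^n$ denote the minimal solution to the McKean--Vlasov equation (stated in the context) with initial data $X_{0-}^n$, and let $\underline{\Lambda}$ denote the minimal solution with initial data $X_{0-}$. Then $\underline{\Lambda}^n\to \underline{\Lambda}$ in $(D([-1,\infty)),\mathrm{M1})$.
   Context: Fix $\alpha>0$. For an interval $I$, $D(I)$ is the space of càdlàg functions $I\to\mathbb{R}$. Elements $f$ of $D([0,\infty))$ carry a prescribed value $f_{0-}=f(0-)$, so a jump at time $0$ is allowed. Let $$M=\{\ell\in D([0,\infty)):\ \ell_{0-}=0,\ \ell\text{ is increasing (non-decreasing)}\}.$$ McKean--Vlasov equation: given an initial condition $X_{0-}$ (a real random variable) and a Brownian motion $B$ (started at $0$) independent of $X_{0-}$, a solution with initial data $X_{0-}$ is a function $\Lambda\in M$ such that $$X_t=X_{0-}+B_t-\Lambda_t\ (t\ge0),\qquad \tau=\inf\{t\ge0:X_t\le0\},\qquad \Lambda_t=\alpha\,\mathbb{P}(\tau\le t)\ (t\ge 0).$$ Minimal solution: for $\ell\in M$ put $X^\ell_t=X_{0-}+B_t-\ell_t$, $\tau^\ell=\inf\{t\ge0:X^\ell_t\le0\}$ and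 $\Gamma[\ell;X_{0-}]_t=\alpha\,\mathbb{P}(\tau^\ell\le t)$, $t\ge0$; let $\Gamma^n[\,\cdot\,;X_{0-}]$ be the $n$-fold iterate of $\Gamma[\,\cdot\,;X_{0-}]$. The minimal solution with initial data $X_{0-}$ is $\underline\Lambda=\lim_{n\to\infty}\Gamma^n[0;X_{0-}]$ (limit in the M1 topology described below). It is known to be a solution, and it is equivalently characterized as the unique solution $\underline\Lambda\in M$ with $\underline\Lambda_t\le\Lambda_t$ for all $t\ge0$ and every solution $\Lambda\in M$ with the same initial data. Topology: every $f\in D([0,\infty))$ is regarded as an element of $D([-1,\infty))$ by setting $f(x)=f(0-)$ for $x\in[-1,0)$. M1 denotes the Skorokhod M1 topology. $f^n\to f$ in $(D([-1,\infty)),\mathrm{M1})$ means that there is a sequence $T_N\nearrow\infty$ such that $f^n\to f$ in $(D([-1,T_N]),\mathrm{M1})$ for all $N$. For non-decreasing functions, convergence in $(D([-1,T]),\mathrm{M1})$ is equivalent to $f^n(t)\to f(t)$ for all $t$ in a dense subset of $[-1,T]$ containing $-1$ and $T$. *)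

(* Defs.v *)
From HB Require Import structures.
From mathcomp Require Import all_boot all_order all_algebra.
From mathcomp Require Import all_classical all_reals all_analysis.

Set Implicit Arguments.
Unset Strict Implicit.
Unset Printing Implicit Defensive.

Import Order.TTheory GRing.Theory Num.Theory.
Import numFieldNormedType.Exports.

Local Open Scope classical_set_scope.
Local Open Scope ring_scope.

(** An element [f] of D([0,oo)), together with its prescribed value f(0-), is
  encoded by its extension to the whole line that is constantly equal to f(0-)
  on the negative half-line.  On [-1,oo) this is exactly the embedding of
  D([0,oo)) into D([-1,oo)). *)

Definition cadlag (R : realType) (f : R -> R) : Prop :=
  right_continuous f /\ forall t : R, cvg (f x @[x --> t^'-]).

Definition M_space (R : realType) : set (R -> R) :=
  [set l | [/\ cadlag l, {homo l : s t / s <= t} & forall t, t < 0 -> l t = 0]].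

(** In the M1 metric of D([a,b]), defined below, only the values of a function
  on [a,b] matter.  Points of the plane are pairs (time, value). *)

(** f(t-), with the convention f(a-) = f(a). *)
Definition left_value (R : realType) (a : R) (f : R -> R) (t : R) : R :=
  if t <= a then f a else lim (f x @[x --> t^'-]).

Definition completed_graph (R : realType) (a b : R) (f : R -> R) :
    set (R * R) :=
  [set p | a <= p.1 <= b /\
     Num.min (left_value a f p.1) (f p.1) <= p.2
       <= Num.max (left_value a f p.1) (f p.1)].

(** The order on the completed graph: by time, and, on a vertical segment, by
  distance to the left limit. *)
Definition graph_le (R : realType) (a : R) (f : R -> R) (p q : R * R) : Prop :=
  p.1 < q.1 \/
  (p.1 = q.1 /\
   `|left_value a f p.1 - p.2| <= `|left_value a f p.1 - q.2|).

Definition parametric_rep (R : realType) (a b : R) (f : R -> R)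
    (g : R -> R * R) : Prop :=
  [/\ {within `[0, 1], continuous g},
      g @` `[0, 1] = completed_graph a b f &
      forall s t, 0 <= s -> s <= t -> t <= 1 -> graph_le a f (g s) (g t)].

(** The norm of R * R is the maximum of the norms of the components, so the
  inner supremum is the maximum of the uniform distances between the time
  components and between the value components. *)
Definition M1_dist (R : realType) (a b : R) (f1 f2 : R -> R) : \bar R :=
  ereal_inf [set e | exists g1 g2 : R -> R * R,
    [/\ parametric_rep a b f1 g1, parametric_rep a b f2 g2 &
        e = ereal_sup [set (`|g1 s - g2 s|)%:E | s in `[0, 1]]]].

(** Convergence in (D([-1,oo)), M1). *)
Definition M1_cvg (R : realType) (fs : nat -> R -> R) (f : R -> R) : Prop :=
  exists T : nat -> R,
    [/\ {homo T : m n / (m <= n)%N >-> m <= n},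
        T N @[N --> \oo] --> +oo,
        forall N, -1 < T N &
        forall N, M1_dist (-1) (T N) (fs n) f @[n --> \oo] --> 0%E].

(** A process indexed by [0,oo) is given as a family indexed by R, of which only
  the members with nonnegative index are used.  All paths, and not only almost
  all of them, start at 0 and are continuous. *)

Definition independent_increments (R : realType) (d : measure_display)
    (T : measurableType d) (P : probability T R)
    (B : R -> {RV P >-> R}) : Prop :=
  forall (k : nat) (t : nat -> R) (A : nat -> set R),
    0 <= t 0%N -> {homo t : m n / (m <= n)%N >-> m <= n} ->
    (forall i, measurable (A i)) ->
    P [set w | forall i, (i < k)%N -> A i (B (t i.+1) w - B (t i) w)] =
    (\prod_(i < k) P [set w | A i (B (t i.+1) w - B (t i) w)%R])%E.

Definition brownian_motion (R : realType) (d : measure_display)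
    (T : measurableType d) (P : probability T R)
    (B : R -> {RV P >-> R}) : Prop :=
  [/\ forall w, B 0 w = 0,
      independent_increments B,
      forall s t, 0 <= s -> s < t -> forall A : set R, measurable A ->
        P [set w | A (B t w - B s w)] = normal_prob 0 (Num.sqrt (t - s)) A &
      forall w, {within `[0, +oo[, continuous (fun t => B t w)}].

Definition process_sigma (R : realType) (d : measure_display)
    (T : measurableType d) (P : probability T R)
    (B : R -> {RV P >-> R}) : set (set T) :=
  <<s [set E | exists t (A : set R),
         [/\ 0 <= t, measurable A & E = B t @^-1` A]] >>.

Definition independent_of_process (R : realType) (d : measure_display)
    (T : measurableType d) (P : probability T R)
    (X : {RV P >-> R}) (B : R -> {RV P >-> R}) : Prop :=
  forall (A : set R) (E : set T), measurable A -> process_sigma B E ->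
    P (X @^-1` A `&` E) = (P (X @^-1` A) * P E)%E.

(** [X] is the initial condition X_{0-}.  The value is +oo if X + B - l never
  hits (-oo,0]. *)
Definition hitting_time (R : realType) (d : measure_display)
    (T : measurableType d) (P : probability T R)
    (X : {RV P >-> R}) (B : R -> {RV P >-> R}) (l : R -> R) (w : T) : \bar R :=
  ereal_inf [set t%:E | t in [set t | 0 <= t /\ X w + B t w - l t <= 0]].

(** For [t < 0] the value is 0, in accordance with the encoding of M. *)
Definition Gamma (R : realType) (alpha : R) (d : measure_display)
    (T : measurableType d) (P : probability T R)
    (X : {RV P >-> R}) (B : R -> {RV P >-> R}) (l : R -> R) : R -> R :=
  fun t => alpha * fine (P [set w | (hitting_time X B l w <= t%:E)%E]).

Definition MV_solution (R : realType) (alpha : R) (d : measure_display)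
    (T : measurableType d) (P : probability T R)
    (X : {RV P >-> R}) (B : R -> {RV P >-> R}) (L : R -> R) : Prop :=
  M_space L /\ forall t, 0 <= t -> L t = Gamma alpha X B L t.

(** [L] is the minimal solution: the M1 limit of the iterates of [Gamma]
  started from 0.  That such a limit satisfies [MV_solution], and lies below
  every other solution, is a theorem and not part of the definition. *)
Definition minimal_solution (R : realType) (alpha : R) (d : measure_display)
    (T : measurableType d) (P : probability T R)
    (X : {RV P >-> R}) (B : R -> {RV P >-> R}) (L : R -> R) : Prop :=
  M_space L /\ M1_cvg (fun n => iter n (Gamma alpha X B) (fun=> 0)) L.

(* Main.v *)
Require Import Defs.
From HB Require Import structures.
From mathcomp Require Import all_boot all_order all_algebra.
From mathcomp Require Import all_classical all_reals all_analysis.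
From mathcomp Require Import measurable_realfun lra ring.

(** Let [S_t(l)] be the supremum of [l - B] over [0, t].  It is attained, because
  [l - B] is upper semicontinuous, so the particle is absorbed by time [t] iff
  [X <= S_t(l)], and [Gamma l t = alpha E[F(S_t(l))]].  The law of [S_t(l)] does
  not depend on the Brownian motion, hence [Gamma] is monotone in [l] and in
  [F].  For [t > 0] this law has no atoms, so dominated convergence shows, by
  induction on [k], that the [k]-th iterates with initial data [X^n] stay below
  the [k]-th iterate with initial data [X] and converge to it at every
  [t > 0].  A minimal solution is the right-continuous version of the supremum
  of its iterates, and these suprema may be exchanged with the limit in [n].
  That the limits solve the equation is never needed. *)

Set Implicit Arguments.
Unset Strict Implicit.
Unset Printing Implicit Defensive.

Import Order.TTheory GRing.Theory Num.Theory.
Import numFieldNormedType.Exports.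

Local Open Scope classical_set_scope.
Local Open Scope ring_scope.

(** * M1 distance of monotone functions *)

(** The pairs (X, B) and (X^n, B^n) live on unrelated probability spaces, so paths cannot be
    compared directly. Once [Gamma] is an expectation of a cdf at a running supremum, everything is
    computed on the space of [B], and the initial law enters only through its cdf. The supremum is
    at least l(0) >= 0, so an ordering of the cdfs on the half-line suffices. Time 0 is exceptional:
    S_0(l) = l(0) is deterministic and may be an atom of the law of X. With X = 0 and X^n = 1/n even
    the first iterates fail to converge there. M1 convergence is therefore handled through two
    bounds that tolerate a shift in time: u_n(t) <= L(t), and L(s) <= u_n(t) + e for s < t and n
    large. The ordering F^n <= F supplies the first one; without such an upper barrier a limit of
    minimal solutions could be a larger solution. *)

Lemma nondecreasing_right_continuousP (R : realType) (f : R -> R) :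
  {homo f : s t / s <= t} -> right_continuous f ->
  forall x e, 0 < e -> exists2 d, 0 < d & f (x + d) <= f x + e.
Proof.
move=> fh fr x e e0.
have /cvgrPdist_lt/(_ _ e0) := fr x.
rewrite near_withinE => /nbhs_ballP[r /= r0 H].
exists (r / 2); first by rewrite divr_gt0.
have : ball x r (x + r / 2).
  rewrite /ball /= opprD addNKr normrN gtr0_norm ?divr_gt0//; lra.
move=> /H; rewrite ltrDl divr_gt0// => /(_ isT).
rewrite distrC => /(le_lt_trans (ler_norm _)); lra.
Qed.

Lemma right_continuous_ge (R : realType) (f : R -> R) (c t : R) :
  right_continuous f -> (forall s, t < s -> c <= f s) -> c <= f t.
Proof.
move=> fr H; rewrite leNgt; apply/negP => ftc.
have /cvgr_lt/(_ _ ftc) := fr t.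
rewrite near_withinE => /nbhs_ballP[r /= r0 /(_ (t + r / 2))].
have h : ball t r (t + r / 2).
  rewrite /ball /= opprD addNKr normrN gtr0_norm ?divr_gt0//; lra.
move=> /(_ h); rewrite ltrDl divr_gt0// => /(_ isT).
by rewrite ltNge H// ltrDl divr_gt0.
Qed.

Section left_value.
Variables (R : realType) (f : R -> R).
Hypothesis fM : M_space f.

Let fh : {homo f : s t / s <= t}. Proof. by case: fM. Qed.
Let fl t : cvg (f x @[x --> t^'-]). Proof. by case: fM => [[]]. Qed.

Lemma left_value_le (a t : R) : a <= t -> left_value a f t <= f t.
Proof.
move=> at_; rewrite /left_value; case: ifPn => _; first exact: fh.
apply: limr_le; first exact: fl.
by near=> x; apply: fh; near: x; exact: nbhs_left_le.
Unshelve. all: by end_near. Qed.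

Lemma le_left_value (a s t : R) : s < t -> a <= t -> f s <= left_value a f t.
Proof.
move=> st at_; rewrite /left_value; case: ifPn => [ta|_].
  by apply: fh; rewrite (le_trans (ltW st)).
apply: limr_ge; first exact: fl.
by near=> x; apply: fh; near: x; exact: nbhs_left_ge.
Unshelve. all: by end_near. Qed.

Lemma left_value_ub (a t c : R) : a < t ->
  (forall s, a < s -> s < t -> f s <= c) -> left_value a f t <= c.
Proof.
move=> at_ H; rewrite /left_value ifN -?ltNge//.
apply: limr_le; first exact: fl.
near=> x; apply: H; near: x; [exact: nbhs_left_gt|exact: nbhs_left_lt].
Unshelve. all: by end_near. Qed.

End left_value.

(** The parameter that sends one graph to (t, f t) sends the other to a point (t', v') of the graph
    of [L] within [e] in both coordinates. There v' lies between the left value and the value of [L]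
    at t', and monotonicity turns this into bounds at nearby times. *)
Lemma M1_dist_bounds (R : realType) (a b e t : R) (f L : R -> R) :
  M_space L -> (M1_dist a b f L < e%:E)%E -> a <= t <= b ->
  L (t - e *+ 2) - e <= f t /\ f t <= L (t + e) + e.
Proof.
move=> LM /ereal_inf_lt[_ [g1 [g2 [r1 r2 ->]] He]] tab.
have Lh : {homo L : s t / s <= t} by case: LM.
have [s s01 g1s] : (g1 @` `[0, 1]) (t, f t).
  by case: r1 => _ -> _; split => //=; rewrite ge_min lexx orbT le_max lexx orbT.
have d12 : `|g1 s - g2 s| < e.
  rewrite -lte_fin; apply: le_lt_trans He; apply: ereal_sup_ubound.
  by exists s.
have [g2t g2v] : completed_graph a b L (g2 s).
  by case: r2 => _ <- _; exists s.
move: d12 g2t g2v; rewrite g1s prod_normE /=; case: (g2 s) => t' v' /=.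
rewrite gt_max => /andP[dt dv] /andP[at' t'b].
rewrite min_l ?max_r ?left_value_le// => /andP[lv vL].
have e0 : 0 < e by exact: le_lt_trans (normr_ge0 _) dt.
move: dt dv; rewrite !ltr_norml => /andP[t1 t2] /andP[v1 v2].
have Ht : L (t - e *+ 2) <= left_value a L t'.
  by apply: le_left_value => //; rewrite mulr2n; lra.
have Ht' : L t' <= L (t + e) by apply: Lh; lra.
by split; lra.
Qed.

(** For [f] in M the map [t |-> t + f t] is strictly increasing, and the level
  [u = t + v] parametrizes the completed graph of [f].  The time component is
  the generalized inverse [graph_time], which is 1-Lipschitz. *)
Section graph_parametrization.
Variables (R : realType) (f : R -> R) (a b : R).
Hypotheses (fM : M_space f) (ab : a <= b).

Let fh : {homo f : s t / s <= t}. Proof. by case: fM. Qed.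
Let fr : right_continuous f. Proof. by case: fM => -[]. Qed.

Definition graph_time (u : R) : R :=
  sup [set t | a <= t <= b /\ t + f t <= u].

Let c := a + f a.
Let e := b + f b.

Let graph_time_has_sup u : c <= u ->
  has_sup [set t | a <= t <= b /\ t + f t <= u].
Proof.
move=> cu; split; first by exists a; rewrite /= lexx ab.
by exists b => t /= [/andP[]].
Qed.

Lemma graph_time_ub u t : a <= t <= b -> t + f t <= u -> t <= graph_time u.
Proof.
move=> tab tu; apply: ub_le_sup => //.
by exists b => x /= [/andP[]].
Qed.

Lemma graph_time_itv u : c <= u -> a <= graph_time u <= b.
Proof.
move=> cu; apply/andP; split.
  by apply: graph_time_ub; rewrite // lexx ab.
apply: ge_sup; first by case: (graph_time_has_sup cu).
by move=> t /= [/andP[]].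
Qed.

Lemma graph_time_le u t : c <= u ->
  (forall s, t < s -> s <= b -> u < s + f s) -> a <= t -> graph_time u <= t.
Proof.
move=> cu H at_; apply: ge_sup; first by case: (graph_time_has_sup cu).
move=> s /= [/andP[as_ sb] su]; rewrite leNgt; apply/negP => /H/(_ sb).
by rewrite ltNge su.
Qed.

Lemma graph_time_mono u v : c <= u -> u <= v -> graph_time u <= graph_time v.
Proof.
move=> cu uv; apply: ge_sup; first by case: (graph_time_has_sup cu).
by move=> s /= [sab su]; apply: graph_time_ub => //; exact: le_trans uv.
Qed.

Lemma graph_time_gt u s : c <= u -> graph_time u < s -> s <= b -> u < s + f s.
Proof.
move=> cu us sb; rewrite ltNge; apply/negP => su.
have /andP[au _] := graph_time_itv cu.
suff : s <= graph_time u by rewrite leNgt us.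
by apply: graph_time_ub => //; rewrite sb (le_trans au (ltW us)).
Qed.

Lemma graph_time_lt u s : c <= u -> s < graph_time u -> s + f s <= u.
Proof.
move=> cu us.
have [|t [/= tab tu] st] := sup_gt _ us; first by case: (graph_time_has_sup cu).
by apply: le_trans tu; apply: lerD; [|apply: fh]; exact: ltW.
Qed.

(** The map t + f t has slope at least 1: moving a time back by [v - u] lowers its level by at least
    [v - u]. *)
Lemma graph_time_lip u v : c <= u -> u <= v ->
  graph_time v <= graph_time u + (v - u).
Proof.
move=> cu uv; have cv := le_trans cu uv.
rewrite leNgt; apply/negP => H.
have [|t [/= tab tv] ht] := sup_gt _ H; first by case: (graph_time_has_sup cv).
have /andP[au _] := graph_time_itv cu.
have : u < (t - (v - u)) + f (t - (v - u)).
  by apply: graph_time_gt => //; lra.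
have : f (t - (v - u)) <= f t by apply: fh; lra.
lra.
Qed.

Lemma graph_time_value u : c <= u -> u <= e ->
  left_value a f (graph_time u) <= u - graph_time u <= f (graph_time u).
Proof.
move=> cu ue; have /andP[au ub] := graph_time_itv cu.
apply/andP; split.
  move: au; rewrite [a <= _]le_eqVlt => /orP[/eqP <-|au].
    by rewrite /left_value lexx; rewrite /c in cu; lra.
  apply/ler_addgt0Pl => d d0.
  set g := graph_time u in au ub *.
  apply: left_value_ub => // s as_ su.
  (* Each s < g is pushed up to within d of g, where the level bound gives f s <= f s' <= u - s' <=
     u - g + d. *)
  set s' := Num.max s (g - d).
  have s's : s <= s' by rewrite le_max lexx.
  have s'd : g - d <= s' by rewrite le_max lexx orbT.
  have s'g : s' < g by rewrite gt_max su ltrBlDr ltrDl.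
  have := graph_time_lt cu s'g; have := fh s's; lra.
move: ub; rewrite [_ <= b]le_eqVlt => /orP[/eqP ->|ub].
  by rewrite /e in ue; lra.
apply/ler_addgt0Pl => d d0.
have [r r0 Hr] := nondecreasing_right_continuousP fh fr (graph_time u)
  (divr_gt0 d0 (ltr0n R 2)).
set g := graph_time u in ub Hr *.
(* A time strictly after g, still in [a, b], and so close that both the time and, by right
   continuity, the value exceed those at g by at most d / 2. *)
set s := Num.min (Num.min b (g + r)) (g + d / 2).
have sb : s <= b by rewrite !ge_min lexx.
have sr : s <= g + r by rewrite !ge_min lexx !orbT.
have sd : s <= g + d / 2 by rewrite ge_min lexx !orbT.
have gs : g < s by rewrite !lt_min ub !ltrDl r0 divr_gt0.
have := graph_time_gt cu gs sb; have := fh sr; lra.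
Qed.

Lemma graph_time_surj t v : a <= t <= b -> left_value a f t <= v <= f t ->
  [/\ c <= t + v, t + v <= e & graph_time (t + v) = t].
Proof.
move=> /andP[at_ tb] /andP[lv vf].
have cv : c <= t + v.
  move: at_ lv; rewrite [a <= t]le_eqVlt => /orP[/eqP <-|at_ lv].
    by rewrite /left_value lexx /c; lra.
  by rewrite /c; have := le_left_value fM at_ (ltW at_); lra.
have ve : t + v <= e by rewrite /e; have := fh tb; lra.
split => //; apply/eqP; rewrite eq_le; apply/andP; split.
  apply: graph_time_le => // s ts sb.
  by have := fh (ltW ts); lra.
move: at_; rewrite [a <= t]le_eqVlt => /orP[/eqP at_|at_].
  by case/andP: (graph_time_itv cv) => + _; rewrite {1}at_.
rewrite leNgt; apply/negP => gt.
set s := (graph_time (t + v) + t) / 2.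
have gs : graph_time (t + v) < s by rewrite /s; lra.
have st : s < t by rewrite /s; lra.
have := graph_time_gt cv gs (le_trans (ltW st) tb).
by have := le_left_value fM st (ltW at_); lra.
Qed.

Definition graph_param (s : R) : R * R :=
  let u := c + s * (e - c) in (graph_time u, u - graph_time u).

Let ce : c <= e. Proof. by rewrite /c /e lerD// fh. Qed.

Let param_itv s : 0 <= s <= 1 -> c <= c + s * (e - c) <= e.
Proof.
move=> /andP[s0 s1]; rewrite lerDl mulr_ge0 ?subr_ge0//=.
have : s * (e - c) <= 1 * (e - c) by rewrite ler_wpM2r// subr_ge0.
lra.
Qed.

Lemma graph_paramP : parametric_rep a b f graph_param.
Proof.
split.
- apply/subspace_continuousP => s /=; rewrite in_itv /= => s01.
  have /andP[cs _] := param_itv s01.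
  apply/cvgrPdist_le => d d0.
  (* The added 1 keeps the divisor positive when c = e, that is, when the graph is a single
     point. *)
  set K := (e - c) + 1.
  have K0 : 0 < K by rewrite /K; have := ce; lra.
  rewrite near_withinE; exists (d / (K *+ 2)) => /=.
    by rewrite divr_gt0// pmulrn_lgt0.
  move=> s' /= ss'; rewrite in_itv /= => s'01.
  have /andP[cs' _] := param_itv s'01.
  set u := c + s * (e - c) in cs *; set u' := c + s' * (e - c) in cs' *.
  have uu' : `|u - u'| <= d / 2.
    have -> : u - u' = (s - s') * (e - c) by rewrite /u /u'; ring.
    rewrite normrM (ger0_norm (_ : 0 <= e - c)) ?subr_ge0//.
    apply: (@le_trans _ _ ((d / (K *+ 2)) * K)).
      apply: ler_pM; rewrite ?subr_ge0//; first exact: ltW.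
      by rewrite /K; lra.
    have -> : d / (K *+ 2) * K = d / 2 by field; rewrite gt_eqF.
    by [].
  have gg' : `|graph_time u - graph_time u'| <= `|u - u'|.
    rewrite ler_norml; case: (leP u u') => [uv|/ltW uv].
      rewrite distrC (ger0_norm (_ : 0 <= u' - u)) ?subr_ge0//.
      have := graph_time_lip cs uv; have := graph_time_mono cs uv; lra.
    rewrite (ger0_norm (_ : 0 <= u - u')) ?subr_ge0//.
    have := graph_time_lip cs' uv; have := graph_time_mono cs' uv; lra.
  rewrite prod_normE /= ge_max; apply/andP; split.
    by apply: (le_trans gg'); lra.
  rewrite -/u -/u' (_ : u - _ - _ = (u - u') - (graph_time u - graph_time u')); last by ring.
  by apply: (le_trans (ler_normB _ _)); lra.
- rewrite predeqE => -[t v]; split => /=.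
    move=> [s]; rewrite in_itv /= => s01 [<- <-].
    have /andP[cu ue] := param_itv s01.
    have /andP[au ub] := graph_time_itv cu.
    split => /=; first by rewrite au.
    rewrite min_l ?max_r ?left_value_le//.
    exact: graph_time_value.
  move=> [/= tab]; case/andP: (tab) => at_ tb.
  rewrite min_l ?max_r ?left_value_le// => lv.
  have [cu ue gt] := graph_time_surj tab lv.
  have [ec|ec] := eqVneq (e - c) 0.
    exists 0; first by rewrite in_itv /= lexx ler01.
    have cE : c = t + v by have := ce; lra.
    by rewrite /graph_param mul0r addr0 cE gt addrAC subrr add0r.
  exists ((t + v - c) / (e - c)).
    rewrite in_itv /= divr_ge0 ?subr_ge0//= ler_pdivrMr; last first.
      by rewrite lt_neqAle eq_sym ec subr_ge0.
    by rewrite mul1r lerD2r.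
  by rewrite /graph_param divfK// addrC subrK gt addrAC subrr add0r.
- move=> s t s0 st t1; rewrite /graph_le /graph_param /=.
  have /andP[cs se] : c <= c + s * (e - c) <= e.
    by apply: param_itv; rewrite s0 (le_trans st).
  have /andP[ct te] : c <= c + t * (e - c) <= e.
    by apply: param_itv; rewrite (le_trans s0 st).
  set u := c + s * (e - c) in cs se *; set u' := c + t * (e - c) in ct te *.
  have uu' : u <= u' by rewrite /u /u' lerD2l ler_wpM2r// subr_ge0.
  have := graph_time_mono cs uu'; rewrite le_eqVlt => /orP[/eqP gg|]; last by left.
  right; split => //.
  (* At equal times both values lie above the left value, so the distances compared by [graph_le]
     are ordered as the levels. *)
  have /andP[lv _] := graph_time_value cs se.
  rewrite distrC ger0_norm ?subr_ge0// distrC ger0_norm -?gg; last first.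
    by rewrite subr_ge0 (le_trans lv)// lerD2r.
  by rewrite !lerD2r.
Qed.

End graph_parametrization.

(** The last three bounds say that [f1] and [f2] are close in the Levy sense on
  [a, b] and close at [b]; they control the distance of the two inverses
  [graph_time] at nearby levels. *)
Lemma M1_dist_le (R : realType) (a b e : R) (f1 f2 : R -> R) :
  M_space f1 -> M_space f2 -> a <= b -> 0 <= e -> f1 a = f2 a ->
  (forall t, f1 t <= f2 t) ->
  (forall t, a <= t -> t + e <= b -> f2 t <= f1 (t + e) + e) ->
  f2 b <= f1 b + e ->
  (M1_dist a b f1 f2 <= (e *+ 3)%:E)%E.
Proof.
move=> M1 M2 ab e0 f12a f12 f21 f21b.
have h1 : {homo f1 : s t / s <= t} by case: M1.
have h2 : {homo f2 : s t / s <= t} by case: M2.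
apply: (@le_trans _ _ (ereal_sup [set
  (`|graph_param f1 a b s - graph_param f2 a b s|)%:E | s in `[0, 1]])).
  apply: ereal_inf_lbound; exists (graph_param f1 a b), (graph_param f2 a b).
  by split => //; exact: graph_paramP.
apply: ge_ereal_sup => _ [s s01 <-].
move: s01; rewrite /= in_itv /= => /andP[s0 s1].
rewrite lee_fin /graph_param f12a.
set c := a + f2 a.
have c1 : c <= b + f1 b by rewrite /c -f12a lerD// h1.
have c2 : c <= b + f2 b by rewrite /c lerD// h2.
set u1 := c + s * (b + f1 b - c); set u2 := c + s * (b + f2 b - c).
have cu1 : c <= u1 by rewrite lerDl mulr_ge0// subr_ge0.
have cu2 : c <= u2 by rewrite lerDl mulr_ge0// subr_ge0.
have u12 : u1 <= u2 by rewrite lerD2l ler_wpM2l// lerD2r lerD2l.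
have u21 : u2 <= u1 + e.
  have -> : u2 = u1 + s * (f2 b - f1 b) by rewrite /u1 /u2; ring.
  rewrite lerD2l; apply: (@le_trans _ _ (1 * e)); last by rewrite mul1r.
  by apply: ler_pM => //; [rewrite subr_ge0|lra].
have cu1' : a + f1 a <= u1 by rewrite f12a.
have cu2' : a + f1 a <= u2 by rewrite f12a.
have u2e : u2 <= u2 + e by rewrite lerDl.
set t1 := graph_time f1 a b u1; set t2 := graph_time f2 a b u2.
have t21 : t2 <= t1 + e.
  have : t2 <= graph_time f1 a b u2.
    apply: ge_sup; first by exists a; rewrite /= lexx ab.
    move=> r /= [rab ru]; apply: graph_time_ub => //.
    by apply: le_trans ru; rewrite lerD2l.
  have := graph_time_lip M1 ab cu1' u12; rewrite -/t1; lra.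
(* If r has [f1]-level at most u1, then r - e has [f2]-level at most u2 + e, by the shifted bound on
   [f2]; returning to level u2 costs another e. If r - e falls before a, then a <= t2 suffices. *)
have t12 : t1 <= t2 + e *+ 2.
  apply: ge_sup; first by exists a; rewrite /= lexx ab.
  move=> r /= [/andP[ar rb] ru].
  have /andP[at2 _] := graph_time_itv ab cu2; rewrite -/t2 in at2.
  case: (leP (r - e) a) => [|/ltW are]; first by rewrite mulr2n; lra.
  have : r - e <= graph_time f2 a b (u2 + e).
    apply: graph_time_ub; first by rewrite are; lra.
    have := f21 _ are; rewrite subrK => /(_ rb); lra.
  have := graph_time_lip M2 ab cu2 u2e; rewrite -/t2 mulr2n; lra.
(* Times differ by at most 2e and levels by at most e, hence values by at most 3e. *)
rewrite prod_normE /= ge_max !ler_norml !mulrSr mulr0n.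
rewrite mulr2n in t12.
by apply/andP; split; apply/andP; split; lra.
Qed.

Lemma countable_compl_dense (R : realType) (A : set R) (a b : R) :
  countable A -> a < b -> exists2 x, a < x < b & ~ A x.
Proof.
move=> cA ab; apply: contrapT => H.
have /countable_lebesgue_measure0 : countable `]a, b[%classic.
  apply: sub_countable cA; apply: subset_card_le => x /=.
  rewrite in_itv /= => xab.
  by apply: contrapT => Ax; apply: H; exists x.
rewrite lebesgue_measure_itv /= lte_fin ab -EFinD => /eqP.
by rewrite eqe subr_eq0 gt_eqF.
Qed.

(** Right continuity of [L] removes the time shift from the upper bound. In the lower bound the gap
    s < t has to remain, since [u] may lag behind a jump of [L]. *)
Lemma M1_cvg_limit (R : realType) (u : nat -> R -> R) (L : R -> R) :
  M_space L -> (forall t, {homo u^~ t : m n / (m <= n)%N >-> m <= n}) ->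
  M1_cvg u L ->
  (forall n t, -1 <= t -> u n t <= L t) /\
  (forall s t e, -1 <= t -> s < t -> 0 < e -> exists n, L s <= u n t + e).
Proof.
move=> LM uh [T [_ Ty T1 Tcvg]].
have Lh : {homo L : s t / s <= t} by case: LM.
have Lr : right_continuous L by case: LM => -[].
have key t e : -1 <= t -> 0 < e -> exists N, forall n, (N <= n)%N ->
    L (t - e *+ 2) - e <= u n t /\ u n t <= L (t + e) + e.
  move=> t1 e0.
  have [k _ Hk] : \forall k \near \oo, t <= T k by move/cvgryPge : Ty; apply.
  have tT := Hk k (leqnn k).
  have /fine_cvgP[fn cv] := Tcvg k.
  have /cvgrPdist_lt/(_ _ e0) cv' := cv.
  have [N _ HN] : \forall n \near \oo, (M1_dist (-1) (T k) (u n) L < e%:E)%E.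
    near=> n.
    rewrite -(@fineK _ (M1_dist _ _ _ _)); last by near: n.
    rewrite lte_fin; apply: le_lt_trans (ler_norm _) _.
    rewrite -normrN -sub0r; near: n; exact: cv'.
  exists N => n Nn; apply: (M1_dist_bounds LM (HN n Nn)).
  by rewrite t1.
split.
  move=> k t t1; apply: right_continuous_ge => // s ts.
  apply/ler_addgt0Pl => d d0.
  have [|N /(_ (maxn N k) (leq_maxl _ _)) [_ H]] := key t (Num.min d (s - t)) t1.
    by rewrite lt_min d0 subr_gt0.
  have m1 : Num.min d (s - t) <= d by rewrite ge_min lexx.
  have m2 : Num.min d (s - t) <= s - t by rewrite ge_min lexx orbT.
  have := uh t k (maxn N k) (leq_maxr _ _).
  have : L (t + Num.min d (s - t)) <= L s by apply: Lh; lra.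
  lra.
move=> s t e t1 st e0.
(* On the left [key] loses twice its error in time, so the error may be half of the gap [t - s]. *)
have [|N /(_ N (leqnn _)) [H _]] := key t (Num.min e ((t - s) / 2)) t1.
  by rewrite lt_min e0 divr_gt0// subr_gt0.
have m1 : Num.min e ((t - s) / 2) <= e by rewrite ge_min lexx.
have m2 : Num.min e ((t - s) / 2) <= (t - s) / 2 by rewrite ge_min lexx orbT.
exists N.
have : L s <= L (t - Num.min e ((t - s) / 2) *+ 2).
  by apply: Lh; rewrite mulr2n; lra.
lra.
Unshelve. all: by end_near. Qed.

Lemma M1_dist_ge0 (R : realType) (a b : R) (f1 f2 : R -> R) :
  (0 <= M1_dist a b f1 f2)%E.
Proof.
apply: le_ereal_inf_tmp => _ [g1 [g2 [_ _ ->]]].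
apply: (@le_trans _ _ (`|g1 0 - g2 0|)%:E); first by rewrite lee_fin.
by apply: ereal_sup_ubound; exists 0 => //=; rewrite in_itv /= lexx ler01.
Qed.

(** Provides the right ends of the intervals in [M1_cvg]: there the values must be close without any
    shift in time. *)
Lemma M_space_continuity_point (R : realType) (L : R -> R) (a b : R) :
  M_space L -> a < b -> exists2 x, a < x < b &
    forall e, 0 < e -> exists2 s, s < x & L x <= L s + e.
Proof.
move=> LM ab.
have Lh : {homo L : s t / s <= t} by case: LM.
have [Lr Ll] : cadlag L by case: LM.
have [x xab xd] : exists2 x, a < x < b &
    ~ (x \in (`]a, b[) /\ discontinuity L x).
  apply: countable_compl_dense ab; apply: discontinuity_countable.
  by move=> s t _ _; exact: Lh.
exists x => // e e0.
have Lx : L y @[y --> x^'-] --> L x.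
  rewrite (_ : L x = lim (L y @[y --> x^'-])); first exact: Ll.
  apply: contrapT => /eqP Lne; apply: xd; split; first by rewrite in_itv.
  split; [exact: Ll|by apply/cvg_ex; exists (L x); exact: Lr|].
  by rewrite eq_sym (cvg_lim _ (Lr x)).
have /cvgr_gt/(_ (L x - e)) := Lx; rewrite ltrBlDr ltrDl => /(_ e0) H.
near x^'- => s; exists s; near: s; first exact: nbhs_left_lt.
by apply: filterS H => s; lra.
Unshelve. all: by end_near. Qed.

Lemma near_forall_ltn (Q : nat -> nat -> Prop) (m : nat) :
  (forall i, \forall n \near \oo, Q i n) ->
  \forall n \near \oo, forall i, (i < m)%N -> Q i n.
Proof.
move=> H; elim: m => [|m IH]; first exact: nearW.
near=> n => i; rewrite ltnS leq_eqVlt => /orP[/eqP ->|]; first by near: n.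
by move: i; near: n.
Unshelve. all: by end_near. Qed.

(** The way back from [M1_cvg_limit]: by monotonicity, bounds at the finitely many points of a grid
    control a whole interval. *)
Lemma M1_cvg_of_bounds (R : realType) (u : nat -> R -> R) (L : R -> R) :
  M_space L -> (forall n, M_space (u n)) -> (forall n t, u n t <= L t) ->
  (forall s t e, s < t -> 0 < e -> \forall n \near \oo, L s <= u n t + e) ->
  M1_cvg u L.
Proof.
move=> LM uM uL Lu.
have Lh : {homo L : s t / s <= t} by case: LM.
have uh n : {homo u n : s t / s <= t} by case: (uM n).
have /choice[T HT] : forall N : nat, exists x, (N%:R < x < N.+1%:R) /\
    forall e, 0 < e -> exists2 s, s < x & L x <= L s + e.
  move=> N; have [|x] := @M_space_continuity_point _ L N%:R N.+1%:R LM.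
    by rewrite ltr_nat.
  by exists x.
have T1 N : -1 < T N.
  have [/andP[NT _] _] := HT N; apply: lt_trans NT.
  by apply: (@lt_le_trans _ _ 0); rewrite ?ltrN10.
exists T; split => //.
- move=> m n; rewrite leq_eqVlt => /orP[/eqP ->//|mn].
  have [/andP[_ mT] _] := HT m; have [/andP[nT _] _] := HT n.
  by rewrite ltW// (lt_trans mT)// (le_lt_trans _ nT)// ler_nat.
- apply/cvgryPge => A; near=> n.
  have [/andP[nT _] _] := HT n; apply: le_trans (ltW nT).
  by near: n; exact: nbhs_infty_ger.
move=> N; set b := T N.
have small e : 0 < e ->
    \forall n \near \oo, (M1_dist (-1) b (u n) L <= (e *+ 3)%:E)%E.
  move=> e0.
  have d0 : 0 < e / 2 by rewrite divr_gt0.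
  (* The second grid point after a time t is then at most e away from t. At b, the errors d from
     continuity and from convergence add up to e. *)
  set d := e / 2 in d0.
  set x := fun i : nat => -1 + i%:R * d.
  have xS i : x i < x i.+1.
    by rewrite /x ltrD2l ltr_pM2r// ltr_nat.
  (* The grid bound is used at the first grid point after t, which may lie one cell past b. *)
  set m := (Num.truncn ((b + 1) / d)).+2.
  have [s sb Ls] := (HT N).2 d d0; rewrite -/b in sb Ls.
  near=> n.
  have Hgrid : forall i, (i < m)%N -> L (x i) <= u n (x i.+1) + e.
    near: n; apply: near_forall_ltn => i; exact: Lu.
  apply: M1_dist_le => //.
  - exact/ltW/T1.
  - exact: ltW.
  - have [_ _ ->] := uM n; last by rewrite ltrN10.
    by have [_ _ ->] := LM; last by rewrite ltrN10.
  - move=> t t1 tb.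
    have t10 : 0 <= (t + 1) / d by apply: divr_ge0; [lra|exact: ltW].
    have /andP[i1 i2] := truncn_itv t10.
    set i := Num.truncn ((t + 1) / d) in i1 i2.
    have im : (i.+1 < m)%N.
      rewrite /m !ltnS; apply: Num.Theory.le_truncn.
      by rewrite ler_pM2r ?invr_gt0//; lra.
    have := Hgrid _ im.
    rewrite ler_pdivlMr// in i1; rewrite ltr_pdivrMr// in i2.
    have : L t <= L (x i.+1) by apply: Lh; rewrite /x; lra.
    have : u n (x i.+2) <= u n (t + e).
      apply: uh; rewrite /x.
      have -> : i.+2%:R = i%:R + 2 :> R by rewrite -natrD addn2.
      by rewrite mulrDl /d in i1 *; lra.
    lra.
  - have : L s <= u n b + d by near: n; exact: Lu.
    by rewrite /d in Ls *; lra.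
apply/fine_cvgP; split.
  have := small 1 ltr01; apply: filterS => n H.
  rewrite ge0_fin_numE ?M1_dist_ge0//.
  by apply: le_lt_trans H _; rewrite ltry.
apply/cvgrPdist_le => e e0.
have := small (e / 3) (divr_gt0 e0 (ltr0n R 3)); apply: filterS => n H.
rewrite sub0r normrN ger0_norm ?fine_ge0 ?M1_dist_ge0//.
rewrite -lee_fin fineK; last first.
  rewrite ge0_fin_numE ?M1_dist_ge0//.
  by apply: le_lt_trans H _; rewrite ltry.
apply: (le_trans H); rewrite lee_fin.
by rewrite -(mulr_natr (e / 3)) divfK// pnatr_eq0.
Unshelve. all: by end_near. Qed.

(** * Running suprema and hitting times *)

Section upper_semicontinuous.
Variables (R : realType) (f : R -> R) (r t : R).
Hypothesis rt : r <= t.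
Hypothesis fu : forall x c, r <= x <= t -> f x < c ->
  exists2 d, 0 < d & forall y, r <= y <= t -> `|y - x| < d -> f y < c.

(** Compactness: the relatively open sets where [f < g n] increase with n and cover [r, t]. The
    thresholds n show that [f] is bounded above; the thresholds [sup E - n.+1%:R^-1] show that the
    supremum cannot be missed. *)
Let uniform_bound (g : nat -> R) : {homo g : m n / (m <= n)%N >-> m <= n} ->
  (forall x, r <= x <= t -> exists n, f x < g n) ->
  exists n, forall x, r <= x <= t -> f x <= g n.
Proof.
move=> gh H.
have /compact_near_coveringP/near_covering_withinP := @segment_compact R r t.
move=> /(_ nat \oo (fun n x => f x <= g n) _); case.
  move=> x; rewrite /= in_itv /= => xrt.
  have [n fg] := H x xrt; have [d d0 Hd] := fu xrt fg.
  exists (ball x d, [set m | (n <= m)%N]) => /=.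
    by split; [exact: nbhsx_ballx|exists n].
  move=> [y m] /= [xy nm]; rewrite in_itv /= => yrt.
  apply: (le_trans _ (gh _ _ nm)); apply/ltW/Hd => //.
  by rewrite distrC.
by move=> n _ /(_ n (leqnn _)) Hn; exists n => x xrt; apply: Hn; rewrite /= in_itv.
Qed.

Lemma usc_max : exists2 s, r <= s <= t & forall x, r <= x <= t -> f x <= f s.
Proof.
have [n Hn] : exists n : nat, forall x, r <= x <= t -> f x <= n%:R.
  apply: uniform_bound => [m n mn|x _]; first by rewrite ler_nat.
  by exists (Num.truncn (f x)).+1; exact: truncnS_gt.
pose E := [set f x | x in `[r, t]].
have E0 : E !=set0.
  by exists (f r), r => //=; rewrite in_itv /= lexx.
have Eub : has_ubound E.
  by exists n%:R => _ [x xrt <-]; move: xrt; rewrite /= in_itv /= => xrt; exact: Hn.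
have leE x : r <= x <= t -> f x <= sup E.
  by move=> xrt; apply: ub_le_sup => //; exists x; rewrite //= in_itv.
apply: contrapT => H.
have [||N HN] := uniform_bound (g := fun n => sup E - n.+1%:R^-1).
- by move=> i j ij; rewrite lerD2l lerN2 lef_pV2 ?posrE// ler_nat.
- move=> x xrt.
  have : f x < sup E.
    rewrite lt_neqAle leE// andbT; apply/eqP => fE; apply: H.
    by exists x => // y yrt; rewrite fE leE.
  by move=> /ltr_add_invr[k Hk]; exists k; rewrite ltrBrDr.
have : sup E <= sup E - N.+1%:R^-1.
  by apply: ge_sup => // _ [x xrt <-]; move: xrt; rewrite /= in_itv /= => xrt; exact: HN.
by apply/negP; rewrite -ltNge ltrBlDr ltrDl invr_gt0 ltr0n.
Qed.

End upper_semicontinuous.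

(** The left end is a parameter because the absence of atoms is shown on [r, t] with r > 0 first,
    where the increments after r are independent of [B r]. *)
Definition running_sup (R : realType) (l b : R -> R) (r t : R) : R :=
  sup [set l s - b s | s in `[r, t]].

(** For j <= 2 ^ m these points contain both ends of [r, t], and the grids are nested in m, so
    suprema over them increase. *)
Definition dyadic_grid (R : realType) (r t : R) (m j : nat) : R :=
  r + (t - r) * (j%:R / 2 ^+ m).

Lemma within_continuous_dist (R : realType) (b : R -> R) :
  {within `[0, +oo[, continuous b} ->
  forall s e, 0 <= s -> 0 < e -> exists2 d, 0 < d &
    forall s', 0 <= s' -> `|s' - s| < d -> `|b s' - b s| < e.
Proof.
move=> /subspace_continuousP bc s e s0 e0.
have /cvgrPdist_lt/(_ _ e0) := bc s ltac:(by rewrite /= in_itv /= s0).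
rewrite near_withinE => /nbhs_ballP[d /= d0 H]; exists d => // s' s'0 ss'.
rewrite distrC; apply: H; first by rewrite /ball /= distrC.
by rewrite in_itv /= s'0.
Qed.

Section running_sup.
Variables (R : realType) (l b : R -> R) (r t : R).
Hypothesis lh : {homo l : s t / s <= t}.
Hypothesis lr : right_continuous l.
Hypothesis bc : {within `[0, +oo[, continuous b}.
Hypotheses (r0 : 0 <= r) (rt : r <= t).

Lemma running_sup_max : exists2 s, r <= s <= t & running_sup l b r t = l s - b s /\
  forall x, r <= x <= t -> l x - b x <= l s - b s.
Proof.
have [|s srt sm] := @usc_max R (fun s => l s - b s) r t rt.
  move=> x c xrt xc.
  have e0 : 0 < (c - (l x - b x)) / 2 by rewrite divr_gt0 ?subr_gt0.
  have x0 : 0 <= x by case/andP: xrt => rx _; exact: le_trans rx.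
  have [d d0 Hd] := within_continuous_dist bc x0 e0.
  have [d' d'0 Hd'] := nondecreasing_right_continuousP lh lr x e0.
  exists (Num.min d d'); first by rewrite lt_min d0.
  move=> y yrt; rewrite lt_min => /andP[/Hd yd yd'].
  have : l y <= l (x + d').
    by apply: lh; move: yd'; rewrite ltr_norml; lra.
  have : `|b y - b x| < (c - (l x - b x)) / 2.
    by apply: yd; case/andP: yrt => ry _; exact: le_trans ry.
  rewrite ltr_norml; lra.
exists s => //; split => //; apply/eqP; rewrite eq_le; apply/andP; split.
  apply: ge_sup; first by exists (l s - b s), s => //=; rewrite in_itv.
  by move=> _ [x xrt <-]; move: xrt; rewrite /= in_itv /= => xrt; exact: sm.
apply: ub_le_sup; last by exists s => //=; rewrite in_itv.
by exists (l s - b s) => _ [x xrt <-]; move: xrt; rewrite /= in_itv /= => xrt; exact: sm.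
Qed.

Lemma running_sup_ub s : r <= s <= t -> l s - b s <= running_sup l b r t.
Proof. by have [s0 _ [-> H]] := running_sup_max => srt; exact: H. Qed.

Lemma running_sup_le c : (forall s, r <= s <= t -> l s - b s <= c) ->
  running_sup l b r t <= c.
Proof. by have [s0 srt [-> _]] := running_sup_max => H; exact: H. Qed.

Lemma dyadic_grid_itv m j : (j <= 2 ^ m)%N -> r <= dyadic_grid r t m j <= t.
Proof.
move=> jm; rewrite /dyadic_grid lerDl mulr_ge0 ?subr_ge0//=.
rewrite -lerBrDl; apply: ler_piMr; first by rewrite subr_ge0.
by rewrite ler_pdivrMr ?exprn_gt0// mul1r -natrX ler_nat.
Qed.

(** A time s < t is approached from the right, where [l] can only grow and [b] is continuous; s = t
    cannot be approached in this way but is itself a grid point. *)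
Lemma dyadic_grid_dense s y : r <= s <= t -> y < l s - b s ->
  exists m j, (j <= 2 ^ m)%N /\
    y < l (dyadic_grid r t m j) - b (dyadic_grid r t m j).
Proof.
move=> /andP[rs]; rewrite le_eqVlt => /orP[/eqP ->|st] ys.
  by exists 0%N, 1%N; rewrite /dyadic_grid expr0 divr1 mulr1 (addrC r) subrK.
have s0 := le_trans r0 rs.
have e0 : 0 < l s - b s - y by rewrite subr_gt0.
have [d d0 Hd] := within_continuous_dist bc s0 e0.
have tr0 : 0 < t - r by rewrite subr_gt0 (le_lt_trans rs).
have [m Hm] : exists m : nat, (t - r) / 2 ^+ m < d.
  exists (Num.truncn ((t - r) / d)).+1.
  rewrite ltr_pdivrMr ?exprn_gt0// mulrC -ltr_pdivrMr//.
  apply: (lt_le_trans (truncnS_gt _)).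
  by rewrite -natrX ler_nat ltnW// ltn_expl.
have x0 : 0 <= (s - r) / (t - r) * 2 ^+ m.
  by rewrite mulr_ge0 ?exprn_ge0// divr_ge0 ?subr_ge0// ltW// subr_gt0.
have /andP[j1 j2] := truncn_itv x0.
set j := Num.truncn _ in j1 j2.
have p0 : 0 < 2 ^+ m :> R by rewrite exprn_gt0.
have g1 : s < dyadic_grid r t m j.+1.
  rewrite /dyadic_grid -ltrBlDl mulrC -ltr_pdivrMr//.
  by rewrite ltr_pdivlMr.
have g2 : dyadic_grid r t m j.+1 < s + d.
  have -> : dyadic_grid r t m j.+1 =
      r + (t - r) * (j%:R / 2 ^+ m) + (t - r) / 2 ^+ m.
    by rewrite /dyadic_grid -natr1; field; rewrite gt_eqF.
  suff : (t - r) * (j%:R / 2 ^+ m) <= s - r by lra.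
  by rewrite mulrC -ler_pdivlMr// ler_pdivrMr.
have jm : (j.+1 <= 2 ^ m)%N.
  rewrite /j truncn_lt_nat// natrX gtr_pMl// ltr_pdivrMr// mul1r.
  by rewrite ltrD2r.
exists m, j.+1; split => //.
have := lh (ltW g1).
have : `|b (dyadic_grid r t m j.+1) - b s| < l s - b s - y.
  apply: Hd; first by rewrite (le_trans s0)// ltW.
  by rewrite ger0_norm ?subr_ge0 ?ltW//; lra.
by rewrite ltr_norml; lra.
Qed.

(** With strict inequality the event is a countable union over grid points, which yields both
    measurability and the transfer of laws. *)
Lemma lt_running_sup y : y < running_sup l b r t <->
  exists m j, (j <= 2 ^ m)%N /\
    y < l (dyadic_grid r t m j) - b (dyadic_grid r t m j).
Proof.
split=> [|[m [j [jm yj]]]].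
  by have [s srt [-> _]] := running_sup_max; exact: dyadic_grid_dense.
by apply: lt_le_trans yj (running_sup_ub _); exact: dyadic_grid_itv.
Qed.

End running_sup.

Lemma running_sup_measurable (R : realType) d (T : measurableType d)
    (B : R -> T -> R) (l : R -> R) (r t : R) :
  {homo l : s t / s <= t} -> right_continuous l ->
  (forall s, 0 <= s -> measurable_fun setT (B s)) ->
  (forall w, {within `[0, +oo[, continuous (B^~ w)}) ->
  0 <= r -> r <= t ->
  measurable_fun setT (fun w => running_sup l (B^~ w) r t).
Proof.
move=> lh lr Bm Bc r0 rt.
apply: (measurability _ (RGenOInfty.measurableE R)) => _ [_ [y ->] <-].
rewrite setTI (_ : _ @^-1` _ = \bigcup_m \bigcup_(j in [set j | (j <= 2 ^ m)%N])
  ((fun w => l (dyadic_grid r t m j) - B (dyadic_grid r t m j) w) @^-1` `]y, +oo[)).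
  apply: bigcup_measurable => m _; apply: bigcup_measurable => j /= jm.
  have /andP[rg _] := dyadic_grid_itv rt jm.
  have mf : measurable_fun setT
      (fun w => l (dyadic_grid r t m j) - B (dyadic_grid r t m j) w).
    by apply: measurable_funB => //; apply: Bm; exact: le_trans rg.
  by rewrite -[_ @^-1` _]setTI; exact: mf.
apply/seteqP; split=> [w /=|w [m _ [j /= jm]] /=].
  rewrite in_itv /= andbT => /(lt_running_sup lh lr (Bc w) r0 rt _).1[m [j [jm Hj]]].
  by exists m => //; exists j => //=; rewrite in_itv /= Hj.
rewrite !in_itv /= !andbT => Hj.
by apply/(lt_running_sup lh lr (Bc w) r0 rt); exists m, j.
Qed.

(** If [X w] exceeds the supremum, no time in [0, t] is a hitting time, and by right continuity the
    gap at t stays open for a while after t. Hence the infimum of the hitting times is beyond t.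
    Conversely, an attained supremum is a hitting time. *)
Lemma hitting_time_le (R : realType) (d : measure_display)
    (T : measurableType d) (P : probability T R)
    (X : {RV P >-> R}) (B : R -> {RV P >-> R}) (l : R -> R) (w : T) (t : R) :
  {homo l : s t / s <= t} -> right_continuous l ->
  {within `[0, +oo[, continuous (fun t => B t w)} -> 0 <= t ->
  (hitting_time X B l w <= t%:E)%E <->
  X w <= running_sup l (fun s => B s w) 0 t.
Proof.
move=> lh lr Bc t0; split=> [ht|Xs]; last first.
  have [s /andP[s0 st] [Es _]] := running_sup_max lh lr Bc (lexx 0) t0.
  apply: (@le_trans _ _ s%:E); last by rewrite lee_fin.
  apply: ereal_inf_lbound; exists s => //=; split => //.
  by move: Xs; rewrite Es; lra.
rewrite leNgt; apply/negP => sX.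
have [s /andP[s0 st] [Es Hs]] := running_sup_max lh lr Bc (lexx 0) t0.
have {}Hs x : 0 <= x <= t -> l x - B x w < X w.
  by move=> /Hs /le_lt_trans; apply; rewrite -Es.
have e0 : 0 < (X w - (l t - B t w)) / 2.
  by rewrite divr_gt0// subr_gt0 Hs// t0 lexx.
have [dd d0 Hd] := within_continuous_dist Bc t0 e0.
have [d' d'0 Hd'] := nondecreasing_right_continuousP lh lr t e0.
have : (t%:E < (t + Num.min dd d')%:E)%E.
  by rewrite lte_fin ltrDl lt_min d0.
move=> /(le_lt_trans ht) /ereal_inf_lt[_ [x /= [x0 xX] <-]].
rewrite lte_fin => xt.
have [xt'|tx] := leP x t.
  by have := Hs x; rewrite x0 xt' => /(_ isT); lra.
have m1 : Num.min dd d' <= dd by rewrite ge_min lexx.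
have m2 : Num.min dd d' <= d' by rewrite ge_min lexx orbT.
have : l x <= l (t + d') by apply: lh; lra.
have : `|B x w - B t w| < (X w - (l t - B t w)) / 2.
  by apply: Hd => //; rewrite ger0_norm ?subr_ge0 ?ltW//; lra.
by rewrite ltr_norml; lra.
Qed.

(** * Laws of running suprema *)

Lemma probability_setU_le (R : realType) d (T : measurableType d)
    (P : probability T R) (A C : set T) :
  measurable A -> measurable C -> (P (A `|` C) <= P A + P C)%E.
Proof. exact: measureU2. Qed.

(** Used with [H = setT], it identifies the laws of [f1] and [f2]; used with
  [P1 = P2] and [f1 = f2], it makes [H] independent of [f1]. *)
Lemma sigma_algebra_transfer (R : realType) d1 (T1 : measurableType d1)
    d2 (T2 : measurableType d2) (P1 : probability T1 R) (P2 : probability T2 R)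
    (U : Type) (G : set (set U)) (f1 : T1 -> U) (f2 : T2 -> U) (H : set T1) :
  setI_closed G -> measurable H ->
  (forall E, G E -> measurable (f1 @^-1` E)) ->
  (forall E, G E -> measurable (f2 @^-1` E)) ->
  (forall E, G E -> P1 (H `&` f1 @^-1` E) = (P1 H * P2 (f2 @^-1` E))%E) ->
  forall E, <<s G >> E -> P1 (H `&` f1 @^-1` E) = (P1 H * P2 (f2 @^-1` E))%E.
Proof.
move=> GI mH m1 m2 GP.
pose D := [set E | [/\ measurable (f1 @^-1` E), measurable (f2 @^-1` E) &
  P1 (H `&` f1 @^-1` E) = (P1 H * P2 (f2 @^-1` E))%E]].
suff : <<s G >> `<=` D by move=> GD E /GD[].
rewrite -(setI_closed_g_dynkin_g_sigma_algebra GI).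
apply: smallest_sub; last by move=> E GE; split; [exact: m1|exact: m2|exact: GP].
split.
- by rewrite /D /= !preimage_setT probability_setT mule1 setIT.
- move=> E [mE1 mE2 EP].
  have pC (T : Type) (f : T -> U) : f @^-1` (~` E) = ~` (f @^-1` E) by [].
  split; rewrite ?pC; [exact: measurableC|exact: measurableC|].
  have -> : P1 (H `&` ~` (f1 @^-1` E)) =
      (P1 H - P1 (H `&` f1 @^-1` E))%E.
    by rewrite -setDE measureD// (le_lt_trans (probability_le1 _ _))// ltry.
  rewrite EP probability_setC//.
  rewrite -[in LHS](fineK (fin_num_measure P1 _ mH)).
  rewrite -[in RHS](fineK (fin_num_measure P1 _ mH)).
  rewrite -(fineK (fin_num_measure P2 _ mE2)).
  by rewrite -(EFinB 1) -!EFinM -EFinB mulrBr mulr1.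
- move=> F tF DF; split; rewrite !preimage_bigcup;
         [by apply: bigcup_measurable => k _; have [] := DF k|
          by apply: bigcup_measurable => k _; have [] := DF k|].
  rewrite setI_bigcupr measure_bigcup//=; last 2 first.
  + by move=> k _; apply: measurableI => //; have [] := DF k.
  + apply: trivIset_setIl.
    by move=> i j _ _ [w []]; rewrite /preimage /= => ? ?; apply: tF => //; exists (f1 w).
  rewrite measure_bigcup//=; last 2 first.
  + by move=> k _; have [] := DF k.
  + by move=> i j _ _ [w []]; rewrite /preimage /= => ? ?; apply: tF => //; exists (f2 w).
  rewrite -(fineK (fin_num_measure P1 _ mH)) -nneseriesZl//.
  apply: eq_eseriesr => k _; rewrite fineK ?fin_num_measure//.
  by have [] := DF k.
Qed.

Lemma real_transfer (R : realType) d1 (T1 : measurableType d1)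
    d2 (T2 : measurableType d2) (P1 : probability T1 R) (P2 : probability T2 R)
    (f1 : T1 -> R) (f2 : T2 -> R) (H : set T1) : measurable H ->
  measurable_fun setT f1 -> measurable_fun setT f2 ->
  (forall y, P1 (H `&` [set w | y < f1 w]) = (P1 H * P2 [set w | (y < f2 w)%R])%E) ->
  forall C, measurable C ->
    P1 (H `&` f1 @^-1` C) = (P1 H * P2 (f2 @^-1` C))%E.
Proof.
move=> mH m1 m2 HP C mC.
have fE (T : Type) (f : T -> R) y : f @^-1` `]y, +oo[ = [set w | y < f w].
  by apply/seteqP; split=> w /=; rewrite in_itv /= andbT.
apply: (@sigma_algebra_transfer _ _ _ _ _ _ _ _ (RGenOInfty.G (R := R))) => //.
- move=> _ _ [x ->] [y ->]; exists (Num.max x y).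
  by apply/seteqP; split=> z /=; rewrite !in_itv /= !andbT gt_max;
    [move=> [-> ->]|move=> /andP[]].
- by move=> _ [y ->]; rewrite -[_ @^-1` _]setTI; apply: m1.
- by move=> _ [y ->]; rewrite -[_ @^-1` _]setTI; apply: m2.
- by move=> _ [y ->]; rewrite !fE.
- by have := mC; rewrite -[X in _ -> X C](RGenOInfty.measurableE R).
Qed.

Lemma rectangle_measurable (R : realType) d (T : measurableType d)
    (Z : nat -> T -> R) (A : nat -> set R) (k : nat) :
  (forall i, measurable_fun setT (Z i)) -> (forall i, measurable (A i)) ->
  measurable [set w | forall i, (i < k)%N -> A i (Z i w)].
Proof.
move=> mZ mA.
rewrite (_ : [set _ | _] = \bigcap_i (if (i < k)%N then Z i @^-1` A i else setT)).
  apply: bigcapT_measurable => i; case: ifP => // _.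
  by rewrite -[_ @^-1` _]setTI; apply: mZ.
apply/seteqP; split=> [w /= H i _|w /= H i ik].
  by case: ifPn => // ik; exact: H.
by have := H i I; rewrite ik.
Qed.

Section partial_sums.
Variables (R : realType) (d1 d2 : measure_display).
Variables (T1 : measurableType d1) (T2 : measurableType d2).
Variables (P1 : probability T1 R) (P2 : probability T2 R).
Variables (Z1 : nat -> T1 -> R) (Z2 : nat -> T2 -> R) (H : set T1) (k : nat).
Hypothesis mH : measurable H.
Hypothesis m1 : forall i, measurable_fun setT (Z1 i).
Hypothesis m2 : forall i, measurable_fun setT (Z2 i).
Hypothesis HP : forall A : nat -> set R, (forall i, measurable (A i)) ->
  P1 (H `&` [set w | forall i, (i < k)%N -> A i (Z1 i w)]) =
  (P1 H * P2 [set w | forall i, (i < k)%N -> A i (Z2 i w)])%E.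

Let G : set (set (nat -> R)) := [set E | exists2 A : nat -> set R,
  (forall i, measurable (A i)) & E = [set z | forall i, (i < k)%N -> A i (z i)]].

(** Independence of increments only speaks of rectangles. These form a pi-system on sequences, and
    the event that some partial sum crosses its level belongs to the sigma-algebra they generate. *)
Lemma partial_sums_transfer (a : nat -> R) (y : R) :
  P1 (H `&` [set w | exists j, (j <= k)%N /\ y < a j - \sum_(i < j) Z1 i w]) =
  (P1 H * P2 [set w | exists j,
    (j <= k)%N /\ (y < a j - \sum_(i < j) Z2 i w)%R])%E.
Proof.
pose E := [set z : nat -> R | exists j, (j <= k)%N /\ y < a j - \sum_(i < j) z i].
suff sE : <<s G >> E.
  apply: (@sigma_algebra_transfer _ _ _ _ _ P1 P2 _ G
    (fun w i => Z1 i w) (fun w i => Z2 i w) H _ _ _ _ _ E sE) => //.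
  - move=> _ _ [A mA ->] [A' mA' ->]; exists (fun i => A i `&` A' i).
      by move=> i; exact: measurableI.
    apply/seteqP; split=> [z [h1 h2] i ik|z h]; first by split; [exact: h1|exact: h2].
    by split=> i ik; have [] := h i ik.
  - by move=> _ [A mA ->]; exact: rectangle_measurable.
  - by move=> _ [A mA ->]; exact: rectangle_measurable.
  - by move=> _ [A mA ->]; exact: HP.
pose V : measurableType _ := g_sigma_algebraType G.
have mz (i : nat) : (i < k)%N -> measurable_fun setT (fun z : V => z i : R).
  move=> ik _ A mA; rewrite setTI; apply: sub_gen_smallest.
  exists (fun j => if j == i then A else setT); first by move=> j; case: ifP.
  apply/seteqP; split=> [z /= zA j jk|z /= /(_ i ik)]; last by rewrite eqxx.
  by case: eqP => // ->.
rewrite (_ : E = \bigcup_(j in [set j | (j <= k)%N])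
    [set z : nat -> R | y < a j - \sum_(i < j) z i]); last first.
  by apply/seteqP; split=> [z [j [jk zj]]|z [j jk zj]]; exists j.
apply: (@bigcup_measurable _ V) => j /= jk.
have mf : measurable_fun setT (fun z : V => a j - \sum_(i < j) z i).
  apply: measurable_funB => //; apply: measurable_sum => i.
  by apply: mz; exact: leq_trans (ltn_ord i) jk.
have := mf measurableT `]y, +oo[%classic (measurable_itv _).
rewrite setTI; congr (measurable _).
by apply/seteqP; split=> z /=; rewrite in_itv /= andbT.
Qed.

End partial_sums.

Lemma dyadic_grid0 (R : realType) (r t : R) m : dyadic_grid r t m 0 = r.
Proof. by rewrite /dyadic_grid mul0r mulr0 addr0. Qed.

Lemma dyadic_grid_double (R : realType) (r t : R) m j :
  dyadic_grid r t m j = dyadic_grid r t m.+1 (2 * j).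
Proof.
rewrite /dyadic_grid exprS natrM; congr (_ + _ * _).
by rewrite -mulf_div divff ?mul1r.
Qed.

Lemma dyadic_grid_mono (R : realType) (r t : R) m : r <= t ->
  {homo dyadic_grid r t m : i j / (i <= j)%N >-> i <= j}.
Proof.
move=> rt i j ij; rewrite /dyadic_grid lerD2l ler_wpM2l ?subr_ge0//.
by rewrite ler_pM2r ?invr_gt0 ?exprn_gt0// ler_nat.
Qed.

Section running_sup_transfer.
Variables (R : realType) (d1 d2 : measure_display).
Variables (T1 : measurableType d1) (T2 : measurableType d2).
Variables (P1 : probability T1 R) (P2 : probability T2 R).
Variables (b1 : R -> T1 -> R) (b2 : R -> T2 -> R) (H : set T1) (l : R -> R).
Variables (r t : R).
Hypotheses (r0 : 0 <= r) (rt : r <= t).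
Hypotheses (lh : {homo l : s t / s <= t}) (lr : right_continuous l).
Hypothesis mH : measurable H.
Hypothesis m1 : forall s, 0 <= s -> measurable_fun setT (b1 s).
Hypothesis m2 : forall s, 0 <= s -> measurable_fun setT (b2 s).
Hypothesis c1 : forall w, {within `[0, +oo[, continuous (b1^~ w)}.
Hypothesis c2 : forall w, {within `[0, +oo[, continuous (b2^~ w)}.
Hypothesis b1r : forall w, b1 r w = 0.
Hypothesis b2r : forall w, b2 r w = 0.
Hypothesis HP : forall m k (A : nat -> set R), (forall i, measurable (A i)) ->
  P1 (H `&` [set w | forall i, (i < k)%N -> A i
    (b1 (dyadic_grid r t m i.+1) w - b1 (dyadic_grid r t m i) w)]) =
  (P1 H * P2 [set w | forall i, (i < k)%N -> A i
    (b2 (dyadic_grid r t m i.+1) w - b2 (dyadic_grid r t m i) w)%R])%E.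

Let g := dyadic_grid r t.

Let g0 m j : 0 <= g m j.
Proof.
by apply: (le_trans r0); rewrite -(dyadic_grid0 r t m); exact: dyadic_grid_mono.
Qed.

Let F (T : Type) (b : R -> T -> R) (y : R) (m : nat) : set T :=
  [set w | exists j, (j <= 2 ^ m)%N /\ y < l (g m j) - b (g m j) w].

Let F_sup (T : Type) (b : R -> T -> R) y :
  (forall w, {within `[0, +oo[, continuous (b^~ w)}) ->
  [set w | y < running_sup l (b^~ w) r t] = \bigcup_m F b y m.
Proof.
move=> bc; apply/seteqP; split=> [w /=|w [m _ [j Hj]] /=].
  by move/(lt_running_sup lh lr (bc w) r0 rt) => [m [j Hj]]; exists m => //; exists j.
by apply/(lt_running_sup lh lr (bc w) r0 rt); exists m, j.
Qed.

Let F_nd (T : Type) (b : R -> T -> R) y : nondecreasing_seq (F b y).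
Proof.
apply/nondecreasing_seqP => m; apply/subsetPset => w [j [jm Hj]].
exists (2 * j)%N; split; first by rewrite expnS leq_mul2l.
by rewrite /g -dyadic_grid_double.
Qed.

Let F_measurable d (T : measurableType d) (b : R -> T -> R) y m :
  (forall s, 0 <= s -> measurable_fun setT (b s)) -> measurable (F b y m).
Proof.
move=> mb; rewrite (_ : F b y m = \bigcup_(j in [set j | (j <= 2 ^ m)%N])
    ((fun w => l (g m j) - b (g m j) w) @^-1` `]y, +oo[)).
  apply: bigcup_measurable => j _.
  have mf : measurable_fun setT (fun w => l (g m j) - b (g m j) w).
    by apply: measurable_funB => //; exact: mb.
  by rewrite -[_ @^-1` _]setTI; exact: mf.
apply/seteqP; split=> [w [j [jm Hj]]|w [j jm /=]].
  by exists j => //=; rewrite in_itv /= Hj.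
by rewrite in_itv /= andbT => Hj; exists j.
Qed.

Let F_sum (T : Type) (b : R -> T -> R) y m : (forall w, b r w = 0) ->
  F b y m = [set w | exists j, (j <= 2 ^ m)%N /\
    y < l (g m j) - \sum_(i < j) (b (g m i.+1) w - b (g m i) w)].
Proof.
move=> br; apply/seteqP; split=> [w [j [jm Hj]]|w [j [jm Hj]]]; exists j; split => //;
  move: Hj; rewrite -(big_mkord predT (fun i => b (g m i.+1) w - b (g m i) w));
  by rewrite telescope_sumr// /g dyadic_grid0 br subr0.
Qed.

(** The event that the supremum exceeds y is an increasing union of dyadic versions. As the paths
    vanish at r, telescoping makes each version depend on grid increments only, and continuity from
    below concludes. *)
Lemma running_sup_transfer C : measurable C ->
  P1 (H `&` [set w | C (running_sup l (b1^~ w) r t)]) =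
  (P1 H * P2 [set w | C (running_sup l (b2^~ w) r t)])%E.
Proof.
move=> mC.
apply: (@real_transfer _ _ _ _ _ P1 P2 (fun w => running_sup l (b1^~ w) r t)
  (fun w => running_sup l (b2^~ w) r t)) => //.
- exact: running_sup_measurable.
- exact: running_sup_measurable.
move=> y; rewrite !F_sup//.
have E m : P1 (H `&` F b1 y m) = (P1 H * P2 (F b2 y m))%E.
  rewrite !F_sum//.
  apply: (@partial_sums_transfer _ _ _ _ _ P1 P2
    (fun i w => b1 (g m i.+1) w - b1 (g m i) w)
    (fun i w => b2 (g m i.+1) w - b2 (g m i) w) H (2 ^ m)%N mH _ _ (HP m (2 ^ m)%N)
    (fun j => l (g m j)) y).
  - by move=> i; apply: measurable_funB; exact: m1.
  - by move=> i; apply: measurable_funB; exact: m2.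
have cv1 : P1 (H `&` F b1 y m) @[m --> \oo] --> P1 (H `&` \bigcup_m F b1 y m).
  rewrite setI_bigcupr; apply: nondecreasing_cvg_mu.
  - by move=> m; apply: measurableI => //; exact: F_measurable.
  - by apply: bigcup_measurable => m _; apply: measurableI => //; exact: F_measurable.
  - by move=> i j ij; apply/subsetPset; apply: setIS; exact/subsetPset/F_nd.
have cv2 : (P1 H * P2 (F b2 y m))%E @[m --> \oo] -->
    (P1 H * P2 (\bigcup_m F b2 y m))%E.
  apply: cvgeZl; first exact: fin_num_measure.
  apply: nondecreasing_cvg_mu => //.
  - by move=> m; exact: F_measurable.
  - by apply: bigcup_measurable => m _; exact: F_measurable.
move: cv1; under eq_fun do rewrite E.
by move=> cv1; exact: (cvg_unique _ cv1 cv2).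
Qed.

End running_sup_transfer.

Definition mfun_of d1 d2 (T1 : measurableType d1) (T2 : measurableType d2)
    (f : T1 -> T2) (mf : measurable_fun setT f) : {mfun T1 >-> T2} :=
  HB.pack f (isMeasurableFun.Build _ _ _ _ f mf).

(** By uniqueness of product measures, the law of the pair is the product of the marginals, which
    integrates sections. *)
Lemma independent_section (R : realType) d (T : measurableType d)
    (P : probability T R) (X Y : {RV P >-> R}) :
  (forall A C, measurable A -> measurable C ->
    P (X @^-1` A `&` Y @^-1` C) = (P (X @^-1` A) * P (Y @^-1` C))%E) ->
  forall E : set (R * R), measurable E ->
  P [set w | E (Y w, X w)] =
  (\int[distribution P Y]_y distribution P X (xsection E y))%E.
Proof.
move=> ind E mE.
have mYX : measurable_fun setT (fun w => (Y w, X w)).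
  exact: measurable_fun_pair.
pose YX : {mfun T >-> (R * R)%type} := mfun_of mYX.
have := @product_measure_unique _ _ _ _ _ (distribution P Y) (distribution P X)
  (distribution P YX) _ E mE.
rewrite -[in X in _ -> X](_ : distribution P YX E = P [set w | E (Y w, X w)])//.
move=> <- // A B mA mB.
rewrite /distribution /pushforward /= muleC -ind//.
by congr (P _); apply/seteqP; split=> w /= [].
Qed.

(** * Brownian motion *)

Lemma normal_prob_nonneg_reals (R : realType) (s : R) : s != 0 ->
  normal_prob 0 s [set x : R | 0 <= x] = (2^-1)%:E.
Proof.
move=> s0.
have := @integral_normal_pdf R 0 s.
rewrite ge0_symfun_integralT.
- rewrite /normal_prob => H.
  set I := integral _ _ _ in H *.
  have : ((2^-1)%:E * (2%:E * I) = (2^-1)%:E)%E by rewrite H mule1.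
  by rewrite muleA -EFinM mulVf// mul1e.
- by move=> x; exact: normal_pdf_ge0.
- exact: continuous_normal_pdf.
- by move=> x; rewrite normal_pdfE//= /normal_fun !subr0 sqrrN.
Qed.

Lemma normal_prob_set1 (R : realType) (s x : R) :
  s != 0 -> normal_prob 0 s [set x] = 0%E.
Proof.
move=> s0; have := @normal_prob_dominates R 0 s.
move=> /null_content_dominatesP; apply => //.
exact: lebesgue_measure_set1.
Qed.

Lemma prode_le_expr (R : realType) (x : nat -> \bar R) (c : R) n :
  (forall i, (i < n)%N -> (0 <= x i <= c%:E)%E) ->
  (\prod_(i < n) x i <= (c ^+ n)%:E)%E.
Proof.
elim: n => [|n IH] H; first by rewrite big_ord0 expr0.
rewrite big_ord_recr /= exprSr EFinM; apply: lee_pmul.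
- by apply: prode_ge0 => i _; have /andP[] := H i (ltn_trans (ltn_ord i) (ltnSn n)).
- by have /andP[] := H n (ltnSn n).
- by apply: IH => i ik; apply: H; exact: ltn_trans (ltnSn n).
- by have /andP[] := H n (ltnSn n).
Qed.

Section brownian_motion.
Variables (R : realType) (d : measure_display) (T : measurableType d).
Variables (P : probability T R) (B : R -> {RV P >-> R}).
Hypothesis BM : brownian_motion B.

Let B0 w : B 0 w = 0. Proof. by case: BM. Qed.
Let Binc : independent_increments B. Proof. by case: BM. Qed.
Let Bcont w : {within `[0, +oo[, continuous (fun t => B t w)}.
Proof. by case: BM. Qed.
Let Bm s : measurable_fun setT (B s). Proof. exact: measurable_funPT. Qed.

Lemma brownian_normal s A : 0 < s -> measurable A ->
  P (B s @^-1` A) = normal_prob 0 (Num.sqrt s) A.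
Proof.
move=> s0 mA; have [_ _ /(_ 0 s (lexx 0) s0 A mA) + _] := BM.
rewrite subr0 => <-; congr (P _).
by apply/seteqP; split=> w /=; rewrite B0 subr0.
Qed.

Lemma brownian_set1 s x : 0 < s -> P (B s @^-1` [set x]) = 0%E.
Proof.
by move=> s0; rewrite brownian_normal// normal_prob_set1// gt_eqF// sqrtr_gt0.
Qed.

Let mB s (b : R) : measurable [set w | b < B s w].
Proof.
rewrite -[X in measurable X]setTI (_ : [set w | b < B s w] = B s @^-1` `]b, +oo[).
  exact: Bm.
by apply/seteqP; split=> w /=; rewrite in_itv /= andbT.
Qed.

(** As a decreases to 0 the events shrink to B_s >= 0, of probability 1/2; any constant strictly
    between 1/2 and 1 could replace 3/4. *)
Lemma brownian_gt_le s : 0 < s ->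
  exists2 a, 0 < a & (P [set w | (- a < B s w)%R] <= (3 / 4)%:E)%E.
Proof.
move=> s0.
pose F (n : nat) := [set w | - n.+1%:R^-1 < B s w].
have cF : P (F n) @[n --> \oo] --> P (\bigcap_n F n).
  apply: nonincreasing_cvg_mu.
  - by rewrite (le_lt_trans (probability_le1 _ _)) ?ltry//; exact: mB.
  - by move=> n; exact: mB.
  - by apply: bigcapT_measurable => n; exact: mB.
  - move=> m n mn; apply/subsetPset => w; rewrite /F /=; apply: le_lt_trans.
    by rewrite lerN2 lef_pV2 ?posrE// ler_nat.
have EF : P (\bigcap_n F n) = (2^-1)%:E.
  rewrite (_ : \bigcap_n F n = B s @^-1` [set x | 0 <= x]); last first.
    apply/seteqP; split=> w /= H.
      rewrite leNgt; apply/negP => Bw.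
      have := ltr_add_invr (_ : B s w < 0) => -/(_ Bw)[n Hn].
      by move: Hn (H n I); rewrite /F /=; set c := n.+1%:R^-1; lra.
    by move=> n _; rewrite /F /=; apply: lt_le_trans H; rewrite oppr_lt0 invr_gt0.
  rewrite brownian_normal//; last by rewrite -set_itvcy.
  by rewrite normal_prob_nonneg_reals// gt_eqF// sqrtr_gt0.
rewrite EF in cF.
have [n _ Hn] : \forall n \near \oo, (P (F n) <= (3 / 4)%:E)%E.
  move/fine_cvgP : cF => [fF /cvgrPdist_le/(_ (4^-1))].
  rewrite invr_gt0 => /(_ (ltr0n _ 4)) cF.
  near=> n.
  have fn : P (F n) \is a fin_num by rewrite fin_num_measure//; exact: mB.
  rewrite -(fineK fn) lee_fin.
  have : `|2^-1 - fine (P (F n))| <= 4^-1 by near: n; exact: cF.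
  rewrite ler_norml; lra.
exists n.+1%:R^-1; first by rewrite invr_gt0.
exact: Hn (leqnn n).
Unshelve. all: by end_near. Qed.

Lemma brownian_small S (a e : R) : 0 < S -> 0 < a -> 0 < e ->
  exists2 s, 0 < s < S & (P [set w | (a <= `|B s w|)%R] <= e%:E)%E.
Proof.
move=> S0 a0 e0.
(* The shift by two keeps already s 0 strictly below S. *)
pose s (n : nat) := S / n.+2%:R.
have mF n : measurable [set w | a <= `|B (s n) w|].
  have mn : measurable_fun setT (fun w => `|B (s n) w|) by exact: measurableT_comp.
  rewrite (_ : [set _ | _] = setT `&` (fun w => `|B (s n) w|) @^-1` `[a, +oo[).
    exact: mn.
  by rewrite setTI; apply/seteqP; split=> w /=; rewrite in_itv /= andbT.
(* Tail unions decrease, and a path lying in all of them would be discontinuous at 0. *)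
pose G n := \bigcup_(m in [set m | (n <= m)%N]) [set w | a <= `|B (s m) w|].
have mG n : measurable (G n) by apply: bigcup_measurable => m _; exact: mF.
have cG : P (G n) @[n --> \oo] --> P (\bigcap_n G n).
  apply: nonincreasing_cvg_mu => //.
  - by rewrite (le_lt_trans (probability_le1 _ _)) ?ltry//; exact: mB.
  - exact: bigcapT_measurable.
  - move=> m n mn; apply/subsetPset => w [k /= nk H]; exists k => //=.
    exact: leq_trans mn nk.
have G0 : \bigcap_n G n = set0.
  rewrite -subset0 => w Gw.
  have [dd d0 Hd] := within_continuous_dist (@Bcont w) (lexx 0) a0.
  have [m /= Nm] := Gw (Num.truncn (S / dd)) I.
  apply/negP; rewrite -ltNge -[B _ _]subr0 -[X in _ - X](B0 w); apply: Hd.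
    by rewrite divr_ge0// ltW.
  rewrite subr0 gtr0_norm ?divr_gt0// ltr_pdivrMr// mulrC -ltr_pdivrMr//.
  by apply: (lt_le_trans (truncnS_gt _)); rewrite ler_nat !ltnS (leq_trans Nm).
rewrite G0 measure0 in cG.
have [n _ Hn] : \forall n \near \oo, (P (G n) <= e%:E)%E.
  move/fine_cvgP : cG => [fG /cvgrPdist_le/(_ _ e0) cG].
  near=> n.
  have fn : P (G n) \is a fin_num by rewrite fin_num_measure.
  rewrite -(fineK fn) lee_fin.
  have : `|0 - fine (P (G n))| <= e by near: n; exact: cG.
  by rewrite sub0r normrN; apply: le_trans; exact: ler_norm.
exists (s n).
  rewrite divr_gt0//= ltr_pdivrMr// ltr_pMr// ltr1n//.
apply: le_trans (Hn n (leqnn n)).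
apply: le_measure; rewrite ?inE//.
by move=> w Hw; exists n => //=.
Unshelve. all: by end_near. Qed.

(** Along times [s_0 > s_1 > ...] decreasing so fast that [B s_(j+1)] is
  negligible with respect to the size [a_j] of [B s_j], each increment
  [B s_j - B s_(j+1)] is at most [- a_j / 2] with probability at least 1/8, and
  these events are independent. *)
Lemma brownian_oscillation t e : 0 < t -> 0 < e ->
  exists N, [/\ measurable N, (P N <= e%:E)%E &
    forall w, (forall s, 0 < s -> s <= t -> 0 < B s w) -> N w].
Proof.
move=> t0 e0.
have [K HK] : exists K : nat, (7 / 8) ^+ K <= e / 2.
  have /cvgrPdist_le/(_ (e / 2)) : (7 / 8 : R) ^+ n @[n --> \oo] --> 0.
    by apply: cvg_expr; rewrite ger0_norm; lra.
  rewrite divr_gt0// => /(_ isT)[K _ /(_ K (leqnn K)) H]; exists K.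
  by move: H; rewrite sub0r normrN ger0_norm// exprn_ge0; lra.
(* The first term turns the bound 3/4 into 7/8; the second keeps the total probability of the K
   exceptional events [F j] below e / 2. *)
pose eta := Num.min (8^-1) (e / 2 / K.+1%:R).
have eta0 : 0 < eta by rewrite lt_min invr_gt0 ltr0n !divr_gt0.
have /choice[a Ha] : forall s, exists a, 0 < s ->
    0 < a /\ (P [set w | (- a < B s w)%R] <= (3 / 4)%:E)%E.
  move=> s; have [s0|s0] := ltP 0 s; last by exists 0.
  by have [a a0 Pa] := brownian_gt_le s0; exists a.
have /choice[nx Hnx] : forall s, exists s', 0 < s -> 0 < s' < s /\
    (P [set w | (a s / 2 <= `|B s' w|)%R] <= eta%:E)%E.
  move=> s; have [s0|s0] := ltP 0 s; last by exists 0.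
  have a0 : 0 < a s / 2 by rewrite divr_gt0//; have [] := Ha s s0.
  by have [s' ss' Ps'] := brownian_small s0 a0 eta0; exists s'.
pose sq j := iter j nx t.
have sq0 j : 0 < sq j.
  by elim: j => //= j IH; have [/andP[]] := Hnx _ IH.
have sqS j : sq j.+1 < sq j by have [/andP[]] := Hnx _ (sq0 j).
have sqt j : sq j <= t.
  by elim: j => //= j IH; apply: le_trans IH; exact/ltW/sqS.
have sqh : {homo sq : i j / (i <= j)%N >-> j <= i}.
  by apply/nonincreasing_seqP => j; exact/ltW/sqS.
(* [A i] means that the drop does not occur. The indices are reversed because
   [independent_increments] takes increasing times, whereas [sq] decreases. *)
pose A i := `]- (a (sq (K - i.+1)%N) / 2), +oo[%classic.
pose tau i := sq (K - i)%N.
pose N1 := [set w | forall i, (i < K)%N -> A i (B (tau i.+1) w - B (tau i) w)].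
pose F j := [set w | a (sq j) / 2 <= `|B (sq j.+1) w|].
have mF j : measurable (F j).
  have mn : measurable_fun setT (fun w => `|B (sq j.+1) w|).
    exact: measurableT_comp.
  rewrite (_ : F j = setT `&` (fun w => `|B (sq j.+1) w|) @^-1` `[a (sq j) / 2, +oo[).
    exact: mn.
  by rewrite setTI; apply/seteqP; split=> w /=; rewrite /F /= in_itv /= andbT.
have mN1 : measurable N1.
  apply: (@rectangle_measurable _ _ _ (fun i w => B (tau i.+1) w - B (tau i) w)).
    by move=> i; exact: measurable_funB.
  by move=> i; exact: measurable_itv.
have mN2 : measurable (\big[setU/set0]_(j < K) F j).
  by apply: bigsetU_measurable => j _.
exists (N1 `|` \big[setU/set0]_(j < K) F j); split.
- exact: measurableU.
- apply: le_trans (probability_setU_le _ mN1 mN2) _.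
  rewrite (_ : e = e / 2 + e / 2); last by lra.
  rewrite EFinD; apply: leeD.
    have -> : P N1 = (\prod_(i < K)
        P [set w | A i (B (tau i.+1) w - B (tau i) w)%R])%E.
      apply: Binc.
      + exact/ltW/sq0.
      + by move=> m n mn; apply: sqh; exact: leq_sub2l.
      + by move=> i; exact: measurable_itv.
    apply: (@le_trans _ _ ((7 / 8) ^+ K)%:E); last by rewrite lee_fin.
    apply: (@prode_le_expr _
      (fun i => P [set w | A i (B (tau i.+1) w - B (tau i) w)%R])) => i iK.
    rewrite measure_ge0/=.
    set j := (K - i.+1)%N.
    have tauS : tau i.+1 = sq j by [].
    have tauE : tau i = sq j.+1 by rewrite /tau /j subnSK.
    rewrite tauS tauE.
    apply: (@le_trans _ _ (P ([set w | (- a (sq j) < B (sq j) w)%R] `|` F j))).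
      apply: le_measure; rewrite ?inE.
      + have mZ : measurable_fun setT (fun w => B (sq j) w - B (sq j.+1) w).
          exact: measurable_funB.
        by rewrite -[X in measurable X]setTI; apply: mZ => //; exact: measurable_itv.
      + by apply: measurableU => //; exact: mB.
      + move=> w; rewrite /A /= in_itv /= andbT -/j => Hw.
        have [|Bw] := ltP (- a (sq j)) (B (sq j) w); first by left.
        by right; rewrite /F /= ler_normr; apply/orP; right; lra.
    apply: le_trans (probability_setU_le _ (mB _ _) (mF j)) _.
    rewrite (_ : 7 / 8 = 3 / 4 + 8^-1 :> R); last by lra.
    rewrite EFinD; apply: leeD; first by have [] := Ha _ (sq0 j).
    have [_ /le_trans] := Hnx _ (sq0 j); apply.
    by rewrite lee_fin ge_min lexx.
  apply: le_trans (Boole_inequality _ _) _ => //.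
  apply: (@le_trans _ _ (\sum_(j < K) (e / 2 / K.+1%:R)%:E)%E).
    apply: lee_sum => j _; have [_ /le_trans] := Hnx _ (sq0 j); apply.
    by rewrite lee_fin ge_min lexx orbT.
  rewrite sumEFin lee_fin sumr_const card_ord -(mulr_natr (e / 2 / K.+1%:R)).
  by rewrite mulrAC ler_pdivrMr// ler_pM2l ?divr_gt0// ler_nat.
(* If a drop of size [a (sq j) / 2] occurs while [B (sq j)] is positive, then [B (sq j.+1)] is at
   least [a (sq j) / 2], which is the event [F j]. *)
- move=> w Hw.
  have [H|] := pselect (N1 w); first by left.
  move=> /existsNP[i /not_implyP[iK]].
  rewrite /A /= in_itv /= andbT => /negP; rewrite -leNgt => Hi.
  right; rewrite -bigcup_mkord.
  have jK : (K - i.+1 < K)%N by rewrite ltn_subrL /=; case: (K) iK.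
  exists (K - i.+1)%N => //.
  have tauE : tau i = sq (K - i.+1).+1 by rewrite /tau subnSK.
  move: Hi; rewrite tauE /F /= /tau.
  have := Hw _ (sq0 (K - i.+1)%N) (sqt _).
  by move=> H1 H2; rewrite ler_normr; apply/orP; left; lra.
Qed.

End brownian_motion.

(** * Running suprema of Brownian paths: uniqueness in law and absence of atoms *)

Lemma brownian_increment_law (R : realType)
    d1 (T1 : measurableType d1) (P1 : probability T1 R) (B1 : R -> {RV P1 >-> R})
    d2 (T2 : measurableType d2) (P2 : probability T2 R) (B2 : R -> {RV P2 >-> R})
    (s t : R) (A : set R) :
  brownian_motion B1 -> brownian_motion B2 -> 0 <= s -> s <= t -> measurable A ->
  P1 [set w | A (B1 t w - B1 s w)] = P2 [set w | A (B2 t w - B2 s w)].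
Proof.
move=> [_ _ n1 _] [_ _ n2 _] s0; rewrite le_eqVlt => /orP[/eqP <- mA|st mA].
  have E (T : Type) (B : R -> T -> R) :
      [set w | A (B s w - B s w)] = if pselect (A 0) then setT else set0.
    by case: pselect => A0; apply/seteqP; split=> w /=; rewrite subrr.
  rewrite (E _ B1) (E _ B2); case: pselect => A0.
    by rewrite !probability_setT.
  by rewrite !measure0.
by rewrite n1// n2.
Qed.

Lemma running_sup_law (R : realType)
    d1 (T1 : measurableType d1) (P1 : probability T1 R) (B1 : R -> {RV P1 >-> R})
    d2 (T2 : measurableType d2) (P2 : probability T2 R) (B2 : R -> {RV P2 >-> R})
    (l : R -> R) (t : R) (C : set R) :
  brownian_motion B1 -> brownian_motion B2 ->
  {homo l : s t / s <= t} -> right_continuous l -> 0 <= t -> measurable C ->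
  P1 [set w | C (running_sup l (fun s => B1 s w) 0 t)] =
  P2 [set w | C (running_sup l (fun s => B2 s w) 0 t)].
Proof.
move=> BM1 BM2 lh lr t0 mC.
rewrite -[X in P1 X]setTI -[RHS]mul1e -(probability_setT P1).
apply: (@running_sup_transfer R _ _ T1 T2 P1 P2 (fun s w => B1 s w)
  (fun s w => B2 s w) setT l 0 t (lexx 0) t0 lh lr measurableT) => //.
- by move=> w; case: BM1.
- by move=> w; case: BM2.
- by move=> w; case: BM1.
- by move=> w; case: BM2.
move=> m k A mA; rewrite probability_setT mul1e setTI.
have g0 : 0 <= dyadic_grid 0 t m 0 by rewrite dyadic_grid0.
have gh := @dyadic_grid_mono R 0 t m t0.
have [_ i1 _ _] := BM1; have [_ i2 _ _] := BM2.
rewrite (i1 k _ _ g0 gh mA) (i2 k _ _ g0 gh mA).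
apply: eq_bigr => i _; apply: (brownian_increment_law BM1 BM2) => //.
  by apply: (le_trans g0); exact: gh.
by apply: gh; exact: leqnSn.
Qed.

Lemma running_sup_shift (R : realType) (l b : R -> R) (c r t : R) :
  {homo l : s t / s <= t} -> right_continuous l ->
  {within `[0, +oo[, continuous b} -> 0 <= r -> r <= t ->
  running_sup l (fun s => b s - c) r t = running_sup l b r t + c.
Proof.
move=> lh lr bc r0 rt.
have bc' : {within `[0, +oo[, continuous (fun s => b s - c)}.
  by move=> x; apply: cvgB; [exact: bc|exact: cvg_cst].
apply/eqP; rewrite eq_le; apply/andP; split.
  apply: running_sup_le => // s srt.
  by have := running_sup_ub lh lr bc r0 rt srt; lra.
rewrite -lerBrDr; apply: running_sup_le => // s srt.
by have := running_sup_ub lh lr bc' r0 rt srt; lra.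
Qed.

Section running_sup_atomless.
Variables (R : realType) (d : measure_display) (T : measurableType d).
Variables (P : probability T R) (B : R -> {RV P >-> R}) (l : R -> R).
Hypothesis BM : brownian_motion B.
Hypotheses (lh : {homo l : s t / s <= t}) (lr : right_continuous l).

Let Bm s : measurable_fun setT (B s). Proof. exact: measurable_funPT. Qed.
Let Bc w : {within `[0, +oo[, continuous (fun s => B s w)}.
Proof. by case: BM. Qed.

Let shift_continuous r w : {within `[0, +oo[, continuous (fun s => B s w - B r w)}.
Proof. by move=> x; apply: cvgB; [exact: Bc|exact: cvg_cst]. Qed.

Let shift_measurable r s : measurable_fun setT (fun w => B s w - B r w).
Proof. exact: measurable_funB. Qed.

Let future_measurable r t : 0 <= r -> r <= t ->
  measurable_fun setT (fun w => running_sup l (fun s => B s w - B r w) r t).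
Proof.
move=> r0 rt; apply: (@running_sup_measurable _ _ _ (fun s w => B s w - B r w)) => //.
Qed.

Lemma brownian_future_independent r t A C : 0 <= r -> r <= t ->
  measurable A -> measurable C ->
  P (B r @^-1` A `&` [set w | C (running_sup l (fun s => B s w - B r w) r t)]) =
  (P (B r @^-1` A) * P [set w | C (running_sup l (fun s => B s w - B r w)%R r t)])%E.
Proof.
move=> r0 rt mA mC.
have mH : measurable (B r @^-1` A) by rewrite -[X in measurable X]setTI; exact: Bm.
apply: (@running_sup_transfer R _ _ T T P P (fun s w => B s w - B r w)
  (fun s w => B s w - B r w) _ l r t r0 rt lh lr mH _ _ _ _ _ _ _ C mC) => //.
- by move=> w; rewrite subrr.
- by move=> w; rewrite subrr.
move=> m k Ak mAk.
have [B0 Bi _ _] := BM.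
pose g := dyadic_grid r t m.
have gh : {homo g : i j / (i <= j)%N >-> i <= j} by exact: dyadic_grid_mono.
have g0 : g 0%N = r by rewrite /g dyadic_grid0.
have simp w i : B (g i.+1) w - B r w - (B (g i) w - B r w) =
    B (g i.+1) w - B (g i) w by lra.
under [X in P (_ `&` X)]eq_set do under eq_forall do rewrite simp.
under [X in (_ * P X)%E]eq_set do under eq_forall do rewrite simp.
(* Time 0 is prepended to the grid, so that [B r] becomes the first of k + 1 independent
   increments. *)
pose t' i := if i is i'.+1 then g i' else 0.
pose A' i := if i is i'.+1 then Ak i' else A.
have mA' i : measurable (A' i) by case: i.
have t'h : {homo t' : i j / (i <= j)%N >-> i <= j}.
  move=> [|i] [|j] //= ij; last exact: gh.
  by rewrite (le_trans r0)// -g0 gh.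
rewrite (Bi k g Ak) ?g0//.
have := Bi k.+1 t' A' (lexx 0) t'h mA'.
rewrite big_ord_recl /= g0.
have -> : [set w | A (B r w - B 0 w)] = B r @^-1` A.
  by apply/seteqP; split=> w /=; rewrite B0 subr0.
move=> <-; congr (P _); apply/seteqP; split.
  move=> w [HA H] [_|i] /=; first by rewrite g0 B0 subr0.
  by rewrite ltnS; exact: H.
move=> w H; split; first by have := H 0%N isT; rewrite /= g0 B0 subr0.
by move=> i ik; exact: (H i.+1).
Qed.

(** The supremum over [r, t] is an independent variable minus [B r], whose law
  has no atom. *)
Let running_sup_set1_pos r t x : 0 < r -> r <= t ->
  P [set w | running_sup l (fun s => B s w) r t = x] = 0%E.
Proof.
move=> r0 rt.
pose W : {RV P >-> R} := mfun_of (future_measurable (ltW r0) rt).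
pose E := [set p : R * R | p.1 - p.2 = x].
have mE : measurable E.
  have mf : measurable_fun setT (fun p : R * R => p.1 - p.2).
    by apply: measurable_funB; [exact: measurable_fst|exact: measurable_snd].
  by rewrite -[E]setTI; apply: (mf measurableT [set x]).
have -> : [set w | running_sup l (fun s => B s w) r t = x] =
    [set w | E (W w, B r w)].
  have WE w : W w = running_sup l (fun s => B s w) r t + B r w.
    by apply: running_sup_shift => //; exact: ltW.
  have EE w : E (W w, B r w) = (running_sup l (fun s => B s w) r t = x).
    by rewrite -[running_sup _ _ _ _](addrK (B r w)) -WE.
  by apply/seteqP; split=> w /=; rewrite EE.
rewrite independent_section//; last first.
  by move=> A C mA mC; exact: (brownian_future_independent (ltW r0) rt mA mC).
apply: integral0_eq => y _.
rewrite (_ : xsection E y = [set y - x]); first exact: brownian_set1.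
apply/seteqP; split=> z; rewrite /xsection /= inE /E /=; lra.
Qed.

(** If the supremum is [x] and is not attained at a positive time, then [x] is
  [l 0] and [B] is positive on [(0, t]], which oscillation excludes. *)
Lemma running_sup_set1 t x : 0 < t ->
  P [set w | running_sup l (fun s => B s w) 0 t = x] = 0%E.
Proof.
move=> t0.
have mS r : 0 <= r -> r <= t ->
    measurable [set w | running_sup l (fun s => B s w) r t = x].
  move=> r0 rt.
  have mf : measurable_fun setT (fun w => running_sup l (fun s => B s w) r t).
    exact: (@running_sup_measurable _ _ _ (fun s w => B s w)).
  by rewrite -[X in measurable X]setTI; apply: (mf measurableT [set x]).
pose r n := t / n.+1%:R.
have r0 n : 0 < r n by rewrite divr_gt0.
have rt n : r n <= t by rewrite ler_pdivrMr// ler_pMr// ler1n.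
pose U := \bigcup_n [set w | running_sup l (fun s => B s w) (r n) t = x].
have mU : measurable U by apply: bigcup_measurable => n _; apply: mS => //; exact: ltW.
have U0 : P U = 0%E.
  apply/eqP; rewrite eq_le measure_ge0 andbT.
  apply: le_trans (generalized_Boole_inequality _ _ _) _ => //.
    by move=> n; apply: mS => //; exact: ltW.
  rewrite eseries0// => n _ _; exact: running_sup_set1_pos.
apply/eqP; rewrite eq_le measure_ge0 andbT.
apply/lee_addgt0Pr => e e0; rewrite add0e.
have [N [mN Ne HN]] := brownian_oscillation BM t0 e0.
apply: (@le_trans _ _ (P (U `|` N))).
  apply: le_measure; rewrite ?inE.
  - by apply: mS => //; exact: ltW.
  - exact: measurableU.
  move=> w /= Sx.
  have [s /andP[s0 st] [Es Hs]] := running_sup_max lh lr (@Bc w) (lexx 0) (ltW t0).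
  have [[s' /andP[s'0 s't] Es']|Hn] := pselect (exists2 s', 0 < s' <= t & l s' - B s' w = x).
    (* This index puts [r n] below s', so the supremum over [r n, t] is x as well. *)
    left; exists (Num.truncn (t / s')) => //=.
    set n := Num.truncn _.
    have rs' : r n <= s'.
      by rewrite ler_pdivrMr// mulrC -ler_pdivrMr// ltW// truncnS_gt.
    apply/eqP; rewrite eq_le; apply/andP; split.
      apply: running_sup_le => //; first exact: ltW.
      move=> y /andP[ry yt]; rewrite -Sx; apply: running_sup_ub => //; first exact: ltW.
      by rewrite yt (le_trans _ ry)// ltW.
    by rewrite -Es'; apply: running_sup_ub => //; [exact: ltW|rewrite rs'].
  right; apply: HN => y y0 yt.
  have sE : s = 0.
    apply/eqP; rewrite eq_le s0 andbT leNgt; apply/negP => s0'.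
    by apply: Hn; exists s; rewrite ?s0'// -Es.
  have [B0 _ _ _] := BM.
  have xE : x = l 0 by rewrite -Sx Es sE B0 subr0.
  have : l y - B y w < x.
    rewrite lt_neqAle; apply/andP; split.
      by apply/eqP => H; apply: Hn; exists y; rewrite // y0.
    by rewrite -Sx Es; apply: Hs; rewrite yt ltW.
  have := lh (ltW y0); lra.
apply: le_trans (probability_setU_le _ mU mN) _.
by rewrite U0 add0e.
Qed.

End running_sup_atomless.

(** * The map Gamma *)

(** The class [M_space] up to left limits, which monotonicity provides; the iterates of [Gamma] stay
    in it. *)
Definition regular_boundary (R : realType) (l : R -> R) : Prop :=
  [/\ {homo l : s t / s <= t}, right_continuous l & forall t, t < 0 -> l t = 0].

Lemma regular_boundary_ge0 (R : realType) (l : R -> R) (t : R) :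
  regular_boundary l -> 0 <= l t.
Proof.
move=> [lh _ l0]; have [t0|t0] := ltP t 0; first by rewrite l0.
have <- : l (-1) = 0 by rewrite l0// ltrN10.
by apply: lh; rewrite (le_trans _ t0)// lerN10.
Qed.

Lemma nondecreasing_right_continuous (R : realType) (f : R -> R) :
  {homo f : s t / s <= t} ->
  (forall x e, 0 < e -> exists2 d, 0 < d & f (x + d) <= f x + e) ->
  right_continuous f.
Proof.
move=> fh H x; apply/cvgrPdist_le => e e0.
have [d d0 Hd] := H x e e0.
near=> y.
have xy : x <= y by near: y; exact: nbhs_right_ge.
have yd : y <= x + d by near: y; apply: nbhs_right_le; rewrite ltrDl.
have := fh _ _ xy; have := fh _ _ yd; rewrite ler_norml; lra.
Unshelve. all: by end_near. Qed.

Section setting.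
Variables (R : realType) (d : measure_display) (T : measurableType d).
Variables (P : probability T R) (X : {RV P >-> R}) (B : R -> {RV P >-> R}).
Hypothesis BM : brownian_motion B.
Let Bm s : measurable_fun setT (B s). Proof. exact: measurable_funPT. Qed.
Let Bc w : {within `[0, +oo[, continuous (fun s => B s w)}.
Proof. by case: BM. Qed.
Let B0 w : B 0 w = 0. Proof. by case: BM. Qed.

Lemma running_sup_brownian_measurable l t : regular_boundary l -> 0 <= t ->
  measurable_fun setT (fun w => running_sup l (fun s => B s w) 0 t).
Proof.
by move=> [lh lr _] t0; exact: (@running_sup_measurable _ _ _ (fun s w => B s w)).
Qed.

Lemma running_sup_brownian_ge0 l t w : regular_boundary l -> 0 <= t ->
  0 <= running_sup l (fun s => B s w) 0 t.
Proof.
move=> lM t0; have [lh lr _] := lM.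
apply: (@le_trans _ _ (l 0 - B 0 w)).
  by rewrite B0 subr0; exact: regular_boundary_ge0.
by apply: (running_sup_ub lh lr (@Bc w)) => //; rewrite lexx.
Qed.

Lemma running_sup_brownian_le l l' t w :
  regular_boundary l -> regular_boundary l' -> 0 <= t -> (forall s, l s <= l' s) ->
  running_sup l (fun s => B s w) 0 t <= running_sup l' (fun s => B s w) 0 t.
Proof.
move=> [lh lr _] [lh' lr' _] t0 ll'.
apply: (running_sup_le lh lr (@Bc w)) => // s st.
apply: le_trans (running_sup_ub lh' lr' (@Bc w) (lexx 0) t0 st).
by rewrite lerD2r.
Qed.

Lemma hitting_setE l t : regular_boundary l -> 0 <= t ->
  [set w | (hitting_time X B l w <= t%:E)%E] =
  [set w | X w <= running_sup l (fun s => B s w) 0 t].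
Proof.
move=> [lh lr _] t0; apply/seteqP.
by split=> w /=; move/(hitting_time_le X lh lr (@Bc w) t0).
Qed.

Lemma hitting_set_lt0 l t : t < 0 ->
  [set w | (hitting_time X B l w <= t%:E)%E] = set0.
Proof.
move=> t0; rewrite -subset0 => w /=; apply/negP; rewrite -ltNge.
apply: (@lt_le_trans _ _ 0%:E); first by rewrite lte_fin.
by apply: le_ereal_inf_tmp => _ [s [s0 _] <-]; rewrite lee_fin.
Qed.

Lemma hitting_set_measurable l t : regular_boundary l ->
  measurable [set w | (hitting_time X B l w <= t%:E)%E].
Proof.
move=> lM; have [t0|t0] := ltP t 0; first by rewrite hitting_set_lt0.
rewrite hitting_setE//.
have mf : measurable_fun setT (fun w => running_sup l (fun s => B s w) 0 t - X w).
  by apply: measurable_funB => //; exact: running_sup_brownian_measurable.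
rewrite (_ : [set _ | _] = setT `&` (fun w =>
    running_sup l (fun s => B s w) 0 t - X w) @^-1` `[0, +oo[).
  exact: mf.
by rewrite setTI; apply/seteqP; split=> w /=; rewrite in_itv /= andbT subr_ge0.
Qed.

Variable alpha : R.
Hypothesis alpha0 : 0 < alpha.

(** Right continuity is continuity from above of P: hitting by time t is the intersection of hitting
    by the times t + 1/(n+1). *)
Lemma Gamma_regular l : regular_boundary l -> regular_boundary (Gamma alpha X B l).
Proof.
move=> lM.
have mH t := hitting_set_measurable t lM.
have fin t : P [set w | (hitting_time X B l w <= t%:E)%E] \is a fin_num.
  by rewrite fin_num_measure.
have Gh : {homo Gamma alpha X B l : s t / s <= t}.
  move=> s t st; rewrite /Gamma ler_pM2l// fine_le//.
  by apply: le_measure; rewrite ?inE// => w /= /le_trans; apply; rewrite lee_fin.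
split => //; last first.
  by move=> t t0; rewrite /Gamma hitting_set_lt0// measure0 mulr0.
apply: nondecreasing_right_continuous => // t e e0.
pose F n := [set w | (hitting_time X B l w <= (t + n.+1%:R^-1)%:E)%E].
have cF : P (F n) @[n --> \oo] --> P (\bigcap_n F n).
  apply: nonincreasing_cvg_mu.
  - by rewrite (le_lt_trans (probability_le1 _ _)) ?ltry//; exact: mH.
  - by move=> n; exact: mH.
  - by apply: bigcapT_measurable => n; exact: mH.
  - move=> m n mn; apply/subsetPset => w; rewrite /F /= => /le_trans; apply.
    by rewrite lee_fin lerD2l lef_pV2 ?posrE// ler_nat.
have EF : \bigcap_n F n = [set w | (hitting_time X B l w <= t%:E)%E].
  apply/seteqP; split=> [w H /=|w /= H n _]; last first.
    by rewrite /F /=; apply: (le_trans H); rewrite lee_fin lerDl.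
  apply/lee_addgt0Pr => r r0; rewrite -EFinD.
  have [n Hn] : exists n : nat, n.+1%:R^-1 < r.
    by have [n] := ltr_add_invr r0; rewrite add0r => ?; exists n.
  by apply: le_trans (H n I) _; rewrite lee_fin lerD2l ltW.
rewrite EF -(fineK (fin t)) in cF.
have /fine_cvgP[_ /cvgrPdist_le/(_ (e / alpha))] := cF.
rewrite divr_gt0// => /(_ isT)[n _ /(_ n (leqnn n)) H].
exists n.+1%:R^-1; first by rewrite invr_gt0.
move: H; rewrite /Gamma /= -/(F n) ler_norml => /andP[+ _].
set x := fine _; set y := fine _ => H.
have : alpha * (- (e / alpha)) <= alpha * (x - y) by rewrite ler_pM2l.
by rewrite mulrN mulrC divfK ?gt_eqF// mulrBr; lra.
Qed.

Lemma Gamma_le l l' t : regular_boundary l -> regular_boundary l' ->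
  (forall s, l s <= l' s) -> Gamma alpha X B l t <= Gamma alpha X B l' t.
Proof.
move=> lM lM' ll'; rewrite /Gamma ler_pM2l//.
have mH := hitting_set_measurable t lM; have mH' := hitting_set_measurable t lM'.
apply: fine_le; rewrite ?fin_num_measure//.
apply: le_measure; rewrite ?inE//.
have [t0|t0] := ltP t 0; first by rewrite hitting_set_lt0.
rewrite !hitting_setE// => w /= /le_trans; apply.
exact: running_sup_brownian_le.
Qed.

Lemma iter_Gamma_regular k :
  regular_boundary (iter k (Gamma alpha X B) (fun=> 0)).
Proof.
elim: k => [|k IH] /=; last exact: Gamma_regular.
by split => // x; exact: cvg_cst.
Qed.

Lemma iter_Gamma_nondecreasing t :
  {homo (fun k => iter k (Gamma alpha X B) (fun=> 0) t) :
    m n / (m <= n)%N >-> m <= n}.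
Proof.
apply/nondecreasing_seqP => k; elim: k t => [|k IH] t.
  by apply: regular_boundary_ge0; exact: iter_Gamma_regular.
exact: (Gamma_le t (iter_Gamma_regular k) (iter_Gamma_regular k.+1) IH).
Qed.

End setting.

(** * Comparison and convergence of [Gamma] across probability spaces *)

Lemma Gamma_integral (R : realType) (alpha : R)
    d (T : measurableType d) (P : probability T R) (B : R -> {RV P >-> R})
    d' (T' : measurableType d') (P' : probability T' R)
    (X' : {RV P' >-> R}) (B' : R -> {RV P' >-> R}) (l : R -> R) (t : R) :
  brownian_motion B -> brownian_motion B' -> independent_of_process X' B' ->
  regular_boundary l -> 0 <= t ->
  Gamma alpha X' B' l t = alpha *
    fine (\int[P]_w cdf X' (running_sup l (fun s => B s w) 0 t))%E.
Proof.
move=> BM BM' ind lM t0; have [lh lr _] := lM.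
rewrite /Gamma hitting_setE//; congr (_ * fine _).
pose S : {RV P >-> R} := mfun_of (running_sup_brownian_measurable BM lM t0).
pose S' : {RV P' >-> R} := mfun_of (running_sup_brownian_measurable BM' lM t0).
pose E := [set p : R * R | p.2 <= p.1].
have mE : measurable E.
  have mf : measurable_fun setT (fun p : R * R => p.1 - p.2).
    by apply: measurable_funB; [exact: measurable_fst|exact: measurable_snd].
  rewrite (_ : E = setT `&` (fun p => p.1 - p.2) @^-1` `[0, +oo[).
    exact: mf.
  by rewrite setTI; apply/seteqP; split=> p; rewrite /E /= in_itv /= andbT subr_ge0.
(* Independence is assumed against [process_sigma], so the supremum must be measurable for the
   sigma-algebra generated by the process itself. *)
pose V : measurableType _ := g_sigma_algebraType [set E | exists t (A : set R),
  [/\ 0 <= t, measurable A & E = B' t @^-1` A]].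
have S'gen : measurable_fun (setT : set V)
    (fun w : V => running_sup l (fun s => B' s w) 0 t).
  apply: (@running_sup_measurable R _ V (fun s w => B' s w)) => //.
    by move=> s s0 _ A mA; rewrite setTI; apply: sub_gen_smallest; exists s, A.
  by have [_ _ _] := BM'.
have -> : [set w | X' w <= running_sup l (fun s => B' s w) 0 t] =
    [set w | E (S' w, X' w)] by [].
rewrite independent_section//; last first.
  move=> A C mA mC; apply: ind => //.
  by have := S'gen measurableT C mC; rewrite setTI.
have xE y : xsection E y = `]-oo, y]%classic.
  by apply/seteqP; split=> z; rewrite /xsection /= inE in_itv.
under eq_integral do rewrite xE.
have := @ge0_integral_distribution _ _ _ _ _ P S _ (cdf_measurable X') (cdf_ge0 X').
move=> <-; apply: eq_measure_integral => A mA _.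
exact: (running_sup_law BM' BM lh lr t0 mA).
Qed.

(** The boundary is enlarged on the space of [X]; what remains compares two cdfs under one
    integral. *)
Lemma Gamma_le_cdf (R : realType) (alpha : R)
    d (T : measurableType d) (P : probability T R)
    (X : {RV P >-> R}) (B : R -> {RV P >-> R})
    d' (T' : measurableType d') (P' : probability T' R)
    (X' : {RV P' >-> R}) (B' : R -> {RV P' >-> R}) (l l' : R -> R) (t : R) :
  0 < alpha -> brownian_motion B -> independent_of_process X B ->
  brownian_motion B' -> independent_of_process X' B' ->
  (forall x, 0 <= x -> (cdf X' x <= cdf X x)%E) ->
  regular_boundary l -> regular_boundary l' -> (forall s, l' s <= l s) ->
  Gamma alpha X' B' l' t <= Gamma alpha X B l t.
Proof.
move=> a0 BM ind BM' ind' F'F lM lM' l'l.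
apply: le_trans (Gamma_le X BM a0 t lM' lM l'l).
have [t0|t0] := ltP t 0.
  by rewrite /Gamma !hitting_set_lt0// !measure0.
rewrite (Gamma_integral alpha BM BM' ind' lM' t0).
rewrite (Gamma_integral alpha BM BM ind lM' t0).
have mS := running_sup_brownian_measurable BM lM' t0.
have mF d1 (T1 : measurableType d1) (P1 : probability T1 R) (X1 : {RV P1 >-> R}) :
    measurable_fun setT (fun w => cdf X1 (running_sup l' (fun s => B s w) 0 t)).
  by apply: measurableT_comp mS; exact: cdf_measurable.
have fin d1 (T1 : measurableType d1) (P1 : probability T1 R) (X1 : {RV P1 >-> R}) :
    (\int[P]_w cdf X1 (running_sup l' (fun s => B s w) 0 t))%E \is a fin_num.
  rewrite ge0_fin_numE; last by apply: integral_ge0 => w _; exact: cdf_ge0.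
  apply: (@le_lt_trans _ _ (\int[P]_w 1)%E); last first.
    rewrite integral_cst// mul1e.
    exact: (le_lt_trans (probability_le1 P measurableT) (ltry 1)).
  by apply: ge0_le_integral => // w _; exact: cdf_le1.
rewrite ler_pM2l//; apply: fine_le => //.
by apply: ge0_le_integral => // w _; apply: F'F; exact: running_sup_brownian_ge0.
Qed.

Section cdf_atom.
Variables (R : realType) (d : measure_display) (T : measurableType d).
Variables (P : probability T R) (X : {RV P >-> R}).

Let fin x : cdf X x \is a fin_num.
Proof. by rewrite fin_num_measure. Qed.

Lemma cdf_left_approx x e : pmf X x = 0 -> 0 < e ->
  exists2 y, y < x & (cdf X x <= cdf X y + e%:E)%E.
Proof.
move=> X0 e0.
pose F n := X @^-1` `]-oo, x - n.+1%:R^-1].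
have mF n : measurable (F n) by exact: measurable_funPTI.
have mU : measurable (\bigcup_n F n) by exact: bigcup_measurable.
have mx : measurable (X @^-1` [set x]) by exact: measurable_funPTI.
have cF : P (F n) @[n --> \oo] --> P (\bigcup_n F n).
  apply: nondecreasing_cvg_mu => // m n mn; apply/subsetPset => w.
  rewrite /F /= !in_itv /= => /le_trans; apply.
  by rewrite lerD2l lerN2 lef_pV2 ?posrE// ler_nat.
have leF : (cdf X x <= P (\bigcup_n F n))%E.
  have P0 : P (X @^-1` [set x]) = 0%E.
    by apply/eqP; rewrite -fine_eq0 ?fin_num_measure//; apply/eqP.
  rewrite -[leRHS]adde0 -P0.
  apply: le_trans (probability_setU_le _ mU mx).
  rewrite -[cdf X x]/(P (X @^-1` `]-oo, x])).
  apply: le_measure; rewrite ?inE; [exact: measurable_funPTI|exact: measurableU|].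
  move=> w /=; rewrite in_itv /= le_eqVlt => /orP[/eqP ->|]; first by right.
  move=> /ltr_add_invr[n Hn]; left; exists n => //.
  by rewrite /F /= in_itv /= lerBrDr ltW.
have finU : P (\bigcup_n F n) \is a fin_num by rewrite fin_num_measure.
rewrite -(fineK finU) in cF leF.
have /fine_cvgP[_ /cvgrPdist_le/(_ e e0)[n _ /(_ n (leqnn n)) /= H]] := cF.
exists (x - n.+1%:R^-1); first by rewrite ltrBlDr ltrDl invr_gt0.
apply: (le_trans leF).
have finF : P (F n) \is a fin_num by rewrite fin_num_measure.
rewrite -[cdf X _]/(P (F n)) -(fineK finF) -EFinD lee_fin.
by move: H; rewrite ler_norml; lra.
Qed.

Lemma cdf_continuous x : pmf X x = 0 -> {for x, continuous (cdf X)}.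
Proof.
move=> X0; suff : cdf X z @[z --> x] --> cdf X x by [].
rewrite -[X in _ --> X](fineK (fin x)); apply/fine_cvgP; split.
  by apply: nearW => y; exact: fin.
apply/cvgrPdist_le => e e0.
have [y yx Hy] := cdf_left_approx X0 e0.
have := @cdf_right_continuous _ _ _ P X x.
rewrite -(fineK (fin x)) => /fine_cvgP[_ /cvgrPdist_le/(_ e e0)].
rewrite near_withinE => Hr.
near=> z; rewrite /= ler_norml.
have Fh s t : s <= t -> fine (cdf X s) <= fine (cdf X t).
  by move=> st; apply: fine_le => //; exact: cdf_nondecreasing.
have [zx|xz] := leP z x.
  have yz : y <= z by apply: ltW; near: z; exact: lt_nbhsr.
  move: Hy; rewrite -(fineK (fin x)) -(fineK (fin y)) -EFinD lee_fin.
  by have := Fh _ _ zx; have := Fh _ _ yz; lra.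
have : x < z -> `|fine (cdf X x) - (fine \o cdf X) z| <= e by near: z.
by move=> /(_ xz); rewrite ler_norml.
Unshelve. all: by end_near. Qed.

End cdf_atom.

(** From above, F^n(x_n) <= F(x_n) <= F(x) at once. From below, F^n(x_n) >= F^n(z) for a continuity
    point z < x with F(z) close to F(x). *)
Lemma cdf_cvg_approx (R : realType) d (T : measurableType d)
    (P : probability T R) (X : {RV P >-> R})
    (dn : nat -> measure_display) (Tn : forall n, measurableType (dn n))
    (Pn : forall n, probability (Tn n) R) (Xn : forall n, {RV (Pn n) >-> R})
    (xn : nat -> R) (x : R) :
  (forall n, 0 <= xn n <= x) ->
  (forall n y, 0 <= y -> (cdf (Xn n) y <= cdf X y)%E) ->
  (forall y, {for y, continuous (cdf X)} ->
    cdf (Xn n) y @[n --> \oo] --> cdf X y) ->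
  (forall y, y < x -> \forall n \near \oo, y < xn n) ->
  pmf X x = 0 ->
  cdf (Xn n) (xn n) @[n --> \oo] --> cdf X x.
Proof.
move=> xn0 XnX Xcvg xcvg X0.
have fin d' (T' : measurableType d') (P' : probability T' R) (X' : {RV P' >-> R}) y :
  cdf X' y \is a fin_num by rewrite fin_num_measure.
have Fh d' (T' : measurableType d') (P' : probability T' R) (X' : {RV P' >-> R}) s t :
    s <= t -> fine (cdf X' s) <= fine (cdf X' t).
  by move=> st; apply: fine_le => //; exact: cdf_nondecreasing.
rewrite -(fineK (fin _ _ _ X x)); apply/fine_cvgP; split.
  by apply: nearW => n; exact: fin.
apply/cvgrPdist_le => e e0.
have e20 : 0 < e / 2 by rewrite divr_gt0.
have [y yx Hy] := cdf_left_approx X0 e20.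
(* At y itself there may be an atom, where pointwise convergence is not assumed; atoms are
   countable, so z avoids them. *)
have [z /andP[yz zx] Hz] := countable_compl_dense (pmf_gt0_countable X) yx.
have Xz : pmf X z = 0.
  apply/eqP; rewrite eq_le pmf_ge0 andbT leNgt; apply/negP; exact: Hz.
have := Xcvg z (cdf_continuous Xz).
rewrite -(fineK (fin _ _ _ X z)) => /fine_cvgP[_ /cvgrPdist_le/(_ _ e20) Cz].
have xz := xcvg z zx.
near=> n; rewrite /= ler_norml.
have [/andP[n0 nx]] := xn0 n.
have H1 : fine (cdf (Xn n) (xn n)) <= fine (cdf X (xn n)).
  by apply: fine_le => //; exact: XnX.
have H2 := Fh _ _ _ X _ _ nx.
have H3 : fine (cdf (Xn n) z) <= fine (cdf (Xn n) (xn n)).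
  by apply: Fh; apply: ltW; near: n.
have H4 : `|fine (cdf X z) - fine (cdf (Xn n) z)| <= e / 2 by near: n.
have H5 := Fh _ _ _ X _ _ (ltW yz).
move: Hy; rewrite -(fineK (fin _ _ _ X x)) -(fineK (fin _ _ _ X y)) -EFinD lee_fin => Hy.
move: H4; rewrite ler_norml; lra.
Unshelve. all: by end_near. Qed.

Lemma running_sup_cvg (R : realType) (ln : nat -> R -> R) (l b : R -> R) (t y : R) :
  (forall n, regular_boundary (ln n)) -> regular_boundary l ->
  {within `[0, +oo[, continuous b} -> 0 < t ->
  (forall s, 0 < s -> ln n s @[n --> \oo] --> l s) ->
  y < running_sup l b 0 t ->
  \forall n \near \oo, y < running_sup (ln n) b 0 t.
Proof.
move=> lnM [lh lr _] bc t0 lcvg yS.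
have [s s0 [st ys]] : exists2 s, 0 < s & s <= t /\ y < l s - b s.
  have [s /andP[s0 st] [Es _]] := running_sup_max lh lr bc (lexx 0) (ltW t0).
  rewrite Es in yS.
  (* Convergence of [ln] is known at positive times only. A maximum at 0 is moved to a small
     positive time, where [l] has not decreased and [b] has barely changed. *)
  have [s0'|s0'] := ltP 0 s; first by exists s.
  have sE : s = 0 by apply/eqP; rewrite eq_le s0 s0'.
  have e0 : 0 < l s - b s - y by rewrite subr_gt0.
  have [dd d0 Hd] := within_continuous_dist bc s0 e0.
  have m0 : 0 < Num.min (dd / 2) t by rewrite lt_min t0 divr_gt0.
  have m1 : Num.min (dd / 2) t <= dd / 2 by rewrite ge_min lexx.
  exists (Num.min (dd / 2) t) => //; split; first by rewrite ge_min lexx orbT.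
  have : `|b (Num.min (dd / 2) t) - b s| < l s - b s - y.
    by apply: Hd; [exact: ltW|rewrite sE subr0 gtr0_norm//; lra].
  have : l s <= l (Num.min (dd / 2) t) by apply: lh; rewrite sE ltW.
  rewrite ltr_norml; lra.
have /cvgr_gt/(_ (y + b s)) := lcvg s s0.
rewrite -ltrBrDr => /(_ ys); apply: filterS => n Hn.
have [lnh lnr _] := lnM n.
apply: (@lt_le_trans _ _ (ln n s - b s)); first by rewrite ltrBrDr.
by apply: running_sup_ub => //; rewrite ?(ltW t0) ?(ltW s0).
Qed.

Lemma measure_preimage_countable (R : realType) d (T : measurableType d)
    (P : probability T R) (S : T -> R) (A : set R) :
  measurable_fun setT S -> countable A ->
  (forall x, P (S @^-1` [set x]) = 0%E) -> P.-negligible (S @^-1` A).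
Proof.
move=> mS /countable_injP[f finj] S0.
have -> : S @^-1` A = \bigcup_n [set w | A (S w) /\ f (S w) = n].
  by apply/seteqP; split=> [w Aw|w [n _ []]//]; exists (f (S w)).
apply: negligible_bigcup => n.
have [[x [Ax fx]]|H] := pselect (exists x, A x /\ f x = n).
  apply: (@negligibleS _ _ _ _ (S @^-1` [set x])).
    move=> w [Aw fw] /=; apply: finj; rewrite ?inE// fx; exact: fw.
  exists (S @^-1` [set x]); split => //; last exact: S0.
  by rewrite -[X in measurable X]setTI; apply: mS.
apply: (@negligibleS _ _ _ _ set0); last exact: negligible_set0.
by move=> w [Aw fw]; apply: H; exists (S w).
Qed.

Lemma Gamma_cvg (R : realType) (alpha : R) (alpha_gt0 : 0 < alpha)
  (d : measure_display) (T : measurableType d) (P : probability T R)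
  (X : {RV P >-> R}) (B : R -> {RV P >-> R})
  (BM : brownian_motion B) (XB : independent_of_process X B)
  (dn : nat -> measure_display) (Tn : forall n, measurableType (dn n))
  (Pn : forall n, probability (Tn n) R)
  (Xn : forall n, {RV (Pn n) >-> R}) (Bn : forall n, R -> {RV (Pn n) >-> R})
  (BMn : forall n, brownian_motion (Bn n))
  (XBn : forall n, independent_of_process (Xn n) (Bn n))
  (F_le : forall n x, 0 <= x -> (cdf (Xn n) x <= cdf X x)%E)
  (F_cvg : forall x : R, {for x, continuous (cdf X)} ->
     cdf (Xn n) x @[n --> \oo] --> cdf X x)
  (ln : nat -> R -> R) (l : R -> R) (t : R) :
  (forall n, regular_boundary (ln n)) -> regular_boundary l ->
  (forall n s, ln n s <= l s) ->
  (forall s, 0 < s -> ln n s @[n --> \oo] --> l s) -> 0 < t ->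
  Gamma alpha (Xn n) (Bn n) (ln n) t @[n --> \oo] --> Gamma alpha X B l t.
Proof.
move=> lnM lM lnl lcvg t0; have t0' := ltW t0.
have [lh lr _] := lM.
rewrite (Gamma_integral alpha BM BM XB lM t0').
under eq_fun do rewrite (Gamma_integral alpha BM (BMn _) (XBn _) (lnM _) t0').
apply: cvgMr.
pose S w := running_sup l (fun s => B s w) 0 t.
pose Sn n w := running_sup (ln n) (fun s => B s w) 0 t.
have mS : measurable_fun setT S by exact: running_sup_brownian_measurable.
have mSn n : measurable_fun setT (Sn n) by exact: running_sup_brownian_measurable.
have [_ _ Icvg] : [/\ P.-integrable setT (fun w => cdf X (S w)),
    [sequence \int[P]_(w in setT)
      `|cdf (Xn n) (Sn n w) - cdf X (S w)|%E]_n @ \oo --> 0%E &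
    [sequence \int[P]_(w in setT) cdf (Xn n) (Sn n w)]_n%E @ \oo -->
      \int[P]_(w in setT) cdf X (S w)]%E.
  apply: (@dominated_convergence _ _ _ P setT measurableT
    (fun n w => cdf (Xn n) (Sn n w)) (fun w => cdf X (S w)) (cst 1%E)).
  - by move=> n; apply: measurableT_comp (mSn n); exact: cdf_measurable.
  - by apply: measurableT_comp mS; exact: cdf_measurable.
  (* Pointwise convergence can fail only where S hits one of the countably many atoms of the law of
     X, a null event because S has no atoms. *)
  - have := measure_preimage_countable mS (pmf_gt0_countable X)
      (fun x => running_sup_set1 BM lh lr x t0).
    apply: negligibleS => w /= Hw; apply: contrapT => /negP; rewrite -leNgt => Xw.
    apply: Hw => _.
    apply: cdf_cvg_approx => //.
    + move=> n; rewrite running_sup_brownian_ge0//=.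
      exact: running_sup_brownian_le.
    + move=> y yS; apply: (running_sup_cvg lnM lM _ t0 lcvg yS).
      by case: BM.
    + by apply/eqP; rewrite eq_le Xw pmf_ge0.
  - exact: finite_measure_integrable_cst.
  - apply: aeW => w n _ /=.
    by rewrite gee0_abs ?cdf_ge0// cdf_le1.
have fin : (\int[P]_w cdf X (S w))%E \is a fin_num.
  rewrite ge0_fin_numE; last by apply: integral_ge0 => w _; exact: cdf_ge0.
  apply: (@le_lt_trans _ _ (\int[P]_w 1)%E); last first.
    rewrite integral_cst// mul1e.
    exact: (le_lt_trans (probability_le1 P measurableT) (ltry 1)).
  apply: ge0_le_integral => //.
    by apply: measurableT_comp mS; exact: cdf_measurable.
  by move=> w _; exact: cdf_le1.
by rewrite -(fineK fin) in Icvg; exact: fine_cvg Icvg.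
Qed.

(** * Exchange of the limits in the iteration and in the initial data *)

Theorem theorem1p8 (R : realType) (alpha : R) (alpha_gt0 : 0 < alpha)
  (d : measure_display) (T : measurableType d) (P : probability T R)
  (X : {RV P >-> R}) (B : R -> {RV P >-> R})
  (BM : brownian_motion B) (XB : independent_of_process X B)
  (dn : nat -> measure_display) (Tn : forall n, measurableType (dn n))
  (Pn : forall n, probability (Tn n) R)
  (Xn : forall n, {RV (Pn n) >-> R}) (Bn : forall n, R -> {RV (Pn n) >-> R})
  (BMn : forall n, brownian_motion (Bn n))
  (XBn : forall n, independent_of_process (Xn n) (Bn n))
  (Xn_ge0 : forall n, {ae Pn n, forall w, 0 <= Xn n w})
  (F_mono : forall (m n : nat) (x : R), (m < n)%N -> 0 <= x ->
     (cdf (Xn m) x <= cdf (Xn n) x /\ cdf (Xn n) x <= cdf X x)%E)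
  (F_cvg : forall x : R, {for x, continuous (cdf X)} ->
     cdf (Xn n) x @[n --> \oo] --> cdf X x)
  (L : R -> R) (Ln : nat -> R -> R)
  (L_min : minimal_solution alpha X B L)
  (Ln_min : forall n, minimal_solution alpha (Xn n) (Bn n) (Ln n)) :
  M1_cvg Ln L.
Proof.
have F_le n x : 0 <= x -> (cdf (Xn n) x <= cdf X x)%E.
  move=> x0; have [H1 H2] := F_mono n n.+1 x (ltnSn n) x0.
  exact: le_trans H1 H2.
pose u k := iter k (Gamma alpha X B) (fun=> 0).
pose un n k := iter k (Gamma alpha (Xn n) (Bn n)) (fun=> 0).
have uM k : regular_boundary (u k) by exact: iter_Gamma_regular.
have unM n k : regular_boundary (un n k) by exact: iter_Gamma_regular.
have un_le n k t : un n k t <= u k t.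
  elim: k t => [//|k IH] t.
  exact: (Gamma_le_cdf t alpha_gt0 BM XB (BMn n) (XBn n) (F_le n) (uM k) (unM n k) IH).
have un_cvg k t : 0 < t -> un n k t @[n --> \oo] --> u k t.
  elim: k t => [|k IH] t t0; first exact: cvg_cst.
  exact: (Gamma_cvg alpha_gt0 BM XB BMn XBn F_le F_cvg (fun n => unM n k) (uM k)
    (fun n s => un_le n k s) IH t0).
have [LM /(M1_cvg_limit LM (iter_Gamma_nondecreasing X BM alpha_gt0))[uL Lu]] := L_min.
have LnM n : M_space (Ln n) by case: (Ln_min n).
have [unLn Lnun] : (forall n k t, -1 <= t -> un n k t <= Ln n t) /\
    (forall n s t e, -1 <= t -> s < t -> 0 < e ->
      exists k, Ln n s <= un n k t + e).
  split=> n; have [_ /(M1_cvg_limit (LnM n)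
    (iter_Gamma_nondecreasing (Xn n) (BMn n) alpha_gt0))[H1 H2]] := Ln_min n.
  - exact: H1.
  - exact: H2.
have N1 (t : R) : 0 <= t -> -1 <= t by apply: le_trans; exact: lerN10.
have [_ _ L0] := LM.
apply: M1_cvg_of_bounds => //.
  move=> n t; have [_ _ Ln0] := LnM n.
  have [t0|t0] := ltP t 0; first by rewrite Ln0// L0.
  (* Bounding [Ln n t] by iterates requires a later time s > t; right continuity of [L] lets s
     return to t. *)
  apply: right_continuous_ge; first by case: LM => -[].
  move=> s ts; apply/ler_addgt0Pl => e e0.
  have s1 : -1 <= s by apply: N1; exact: le_trans (ltW ts).
  have [k Hk] := Lnun n t s e s1 ts e0.
  by have := un_le n k s; have := uL k s s1; rewrite -/(u k) => H1 H2; lra.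
move=> s t e st e0.
(* The iterates need not converge at time 0, but s < t <= 0 forces L s = 0. *)
have [t0|t0] := leP t 0.
  apply: nearW => n; have [_ Lnh Ln0] := LnM n.
  rewrite L0 ?(lt_le_trans st)//.
  have := Lnh _ _ (ltW st); rewrite Ln0 ?(lt_le_trans st)//; lra.
have e20 : 0 < e / 2 by rewrite divr_gt0.
have t1 : -1 <= t by apply: N1; exact: ltW.
(* The number k of iterations is fixed before n grows, so no uniformity in k is required. *)
have [k Hk] := Lu s t (e / 2) t1 st e20.
have /cvgrPdist_le/(_ _ e20) := un_cvg k t t0.
apply: filterS => n; rewrite ler_norml => /andP[_ Hn].
have := unLn n k t t1; move: Hk; rewrite -/(u k) => Hk; lra.
Qed.
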